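(* Let $R$, $I=(\phi_1,\dots,\phi_n)$, $F_\bullet$ be as in the context. Assume $R/I$ is a ring of Tor-algebra class $G(r)$, $F_\bullet$ is in standard form with $F_1\cdot_FF_1\subseteq\mathfrak m^2F_2$, and $d_2(F_2)\subseteq\mathfrak m^2F_1$. Then for every indexing set $\sigma=(1\le\sigma_1<\dots<\sigma_t\le n)$, $\operatorname{tm}_\sigma(I)$ defines a ring of Tor-algebra class $G(r-|\sigma\cap[r]|)$, where $[r]=\{1,\dots,r\}$.
   Context: Setting. $(R,\mathfrak m,k)$ is a regular local ring of dimension $3$; $I=(\phi_1,\dots,\phi_n)\subseteq R$ is an ideal with $\operatorname{pd}_R(R/I)=3$. $(F_\bullet,d_\bullet)$ is a minimal DG-algebra (associative, graded-commutative) free resolution of $R/I$, with product written $\cdot_F$. The basis $f_1^1,\dots,f_1^n$ of $F_1$ satisfies $d_1(f_1^i)=\phi_i$. ''An ideal defines a ring of class X'' means the quotient of $R$ by that ideal has that class. Trimming: $\operatorname{tm}_\sigma(I):=(\phi_i\mid i\notin\sigma)+\mathfrak m(\phi_j\mid j\in\sigma)$. Tor-algebra class: for an ideal $I$ with $\operatorname{pd}_R(R/I)=3$, $R/I$ has class $G(r)$ if there are bases $\{\overline{f_1^i}\},\{\overline{f_2^i}\},\{\overline{f_3^i}\}$ of $\operatorname{Tor}_1^R(R/I,k),\operatorname{Tor}_2^R(R/I,k),\operatorname{Tor}_3^R(R/I,k)$ in which the only nonzero products of basis elements in positive degrees (up to graded commutativity) are $\overline{f_1^i}\,\overline{f_2^i}=\overline{f_3^1}$,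 $1\le i\le r$ (so for $r=0$ the multiplication on $\operatorname{Tor}_+$ is zero). The DG-algebra resolution $F_\bullet$ is in standard form if it has bases $\{f_1^i\},\{f_2^i\},\{f_3^i\}$ whose images in $F_\bullet\otimes_Rk=\operatorname{Tor}^R_\bullet(R/I,k)$ have this multiplication table. *)

(* Defs.v *)
From HB Require Import structures.
From mathcomp Require Import all_boot all_algebra.
From mathcomp Require Import boolp classical_sets.
Set Implicit Arguments.
Unset Strict Implicit.
Unset Printing Implicit Defensive.
Import GRing.Theory.
Local Open Scope classical_set_scope.
Local Open Scope ring_scope.

(* Ideals and submodules are Prop-valued sets; an ideal of R is also seen as a
   subset of the regular module R^o. *)

Section Modules.
Variable R : comNzRingType.

(* J V: all finite sums of products a v with a in J and v in V. *)
Definition smul (M : lmodType R) (J : set R) (V : set M) : set M :=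
  [set x | exists (k : nat) (a : 'I_k -> R) (v : 'I_k -> M),
    [/\ forall i, J (a i), forall i, V (v i) & x = \sum_i a i *: v i]].

Definition span (M : lmodType R) (V : set M) : set M := smul [set: R] V.

Definition ideal_gen (S : set R) : set R := @span R^o S.

Definition ideal_mul (J K : set R) : set R := @smul R^o J K.

Definition ideal_add (J K : set R) : set R :=
  [set x | exists y z, [/\ J y, K z & x = y + z]].

Definition is_basis (M : lmodType R) (n : nat) (f : 'I_n -> M) : Prop :=
  forall x, exists! a : 'rV[R]_n, x = \sum_i a 0 i *: f i.

Definition finite_free (M : lmodType R) : Prop :=
  exists (n : nat) (f : 'I_n -> M), is_basis f.

Definition surj (M N : lmodType R) (g : M -> N) : Prop :=
  forall y, exists x, g x = y.

Definition exact (L M N : lmodType R) (f : L -> M) (g : M -> N) : Prop :=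
  forall x, g x = 0 <-> exists y, f y = x.

Definition projective (P : lmodType R) : Prop :=
  forall (M N : lmodType R) (g : {linear M -> N}) (f : {linear P -> N}),
    surj g -> exists h : {linear P -> M}, forall x, g (h x) = f x.

Definition pd_le (M : lmodType R) (d : nat) : Prop :=
  exists (P : nat -> lmodType R) (e : {linear P 0%N -> M})
         (f : forall i, {linear P i.+1 -> P i}),
    [/\ forall i, projective (P i), surj e, exact (f 0%N) e,
        forall i, exact (f i.+1) (f i) &
        forall i, (d < i)%N -> forall x : P i, x = 0].

Definition pd_eq (M : lmodType R) (d : nat) : Prop :=
  pd_le M d /\ forall e, pd_le M e -> (d <= e)%N.

(* pd_R(R/J) = d, for M any model of the quotient module R/J. *)
Definition pd_quot_eq (J : set R) (d : nat) : Prop :=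
  exists (M : lmodType R) (pi : {linear R^o -> M}),
    [/\ surj pi, forall x, pi x = 0 <-> J x & pd_eq M d].

End Modules.

Section RegularLocal.
Variable R : comNzRingType.

Definition is_ideal (J : set R) : Prop :=
  [/\ J 0, forall x y, J x -> J y -> J (x + y) & forall a x, J x -> J (a * x)].

Definition prime_ideal (P : set R) : Prop :=
  [/\ is_ideal P, ~ P 1 & forall x y, P (x * y) -> P x \/ P y].

Definition maximal_ideal (m : set R) : Prop :=
  [/\ is_ideal m, ~ m 1 &
      forall J, is_ideal J -> ~ J 1 -> m `<=` J -> J = m].

Definition local_ring (m : set R) : Prop :=
  maximal_ideal m /\ forall m', maximal_ideal m' -> m' = m.

Definition noetherian : Prop :=
  forall J : set R, is_ideal J ->
    exists (n : nat) (a : 'I_n -> R), J = ideal_gen (range a).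

Definition prime_chain (d : nat) : Prop :=
  exists P : nat -> set R,
    (forall i, (i <= d)%N -> prime_ideal (P i)) /\
    (forall i, (i < d)%N -> P i `<` P i.+1).

Definition krull_dim_eq (d : nat) : Prop :=
  prime_chain d /\ forall e, prime_chain e -> (e <= d)%N.

Definition regular_local_ring (m : set R) (d : nat) : Prop :=
  [/\ noetherian, local_ring m, krull_dim_eq d &
      exists a : 'I_d -> R, m = ideal_gen (range a)].

End RegularLocal.

(* The data of a graded R-algebra with differential R <- F1 <- F2 <- F3 with
   F0 = R acting by scalars. Only the products F1 x F1 -> F2 and F1 x F2 -> F3
   are recorded: F2 x F1 -> F3 is determined by graded commutativity, z.x = x.z
   for x in F1 and z in F2, and all other products of positive degree lie in
   degree > 3, hence vanish. *)
Record dg_data (R : comNzRingType) := DGData {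
  F1 : lmodType R;
  F2 : lmodType R;
  F3 : lmodType R;
  d1 : {linear F1 -> R^o};
  d2 : {linear F2 -> F1};
  d3 : {linear F3 -> F2};
  mul11 : F1 -> F1 -> F2;
  mul12 : F1 -> F2 -> F3
}.
Arguments d1 {R} _.
Arguments d2 {R} _.
Arguments d3 {R} _.
Arguments mul11 {R} _.
Arguments mul12 {R} _.

Section DG.
Variables (R : comNzRingType) (m : set R).

(* The last two Leibniz rules are those of the products F2 x F2 and F1 x F3,
   which are zero. *)
Record is_dg_algebra (F : dg_data R) : Prop := IsDGAlgebra {
  mul11_linr : forall x, linear (mul11 F x);
  mul11_linl : forall y, linear (fun x => mul11 F x y);
  mul12_linr : forall x, linear (mul12 F x);
  mul12_linl : forall z, linear (fun x => mul12 F x z);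
  mul11_anticomm : forall x y : F1 F, mul11 F x y = - mul11 F y x;
  mul11_alt : forall x : F1 F, mul11 F x x = 0;
  mul_assoc : forall x y z : F1 F, mul12 F x (mul11 F y z) = mul12 F z (mul11 F x y);
  d1_d2 : forall z : F2 F, d1 F (d2 F z) = 0;
  d2_d3 : forall u : F3 F, d2 F (d3 F u) = 0;
  leibniz11 : forall x y : F1 F, d2 F (mul11 F x y) = d1 F x *: y - d1 F y *: x;
  leibniz12 : forall (x : F1 F) (z : F2 F),
    d3 F (mul12 F x z) = d1 F x *: z - mul11 F x (d2 F z);
  leibniz22 : forall z w : F2 F, mul12 F (d2 F z) w + mul12 F (d2 F w) z = 0;
  leibniz13 : forall (x : F1 F) (u : F3 F), d1 F x *: u - mul12 F x (d3 F u) = 0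
}.

(* F is a length 3 resolution of R/J by free modules of finite rank. *)
Definition is_free_resolution (J : set R) (F : dg_data R) : Prop :=
  [/\ finite_free (F1 F), finite_free (F2 F) & finite_free (F3 F)] /\
  [/\ forall a : R, J a <-> exists x : F1 F, d1 F x = a,
      exact (d2 F) (d1 F),
      exact (d3 F) (d2 F) &
      injective (d3 F)].

Definition is_minimal (F : dg_data R) : Prop :=
  [/\ forall x : F1 F, m (d1 F x),
      forall z : F2 F, smul m [set: F1 F] (d2 F z) &
      forall u : F3 F, smul m [set: F2 F] (d3 F u)].

Definition minimal_dg_resolution (J : set R) (F : dg_data R) : Prop :=
  [/\ is_dg_algebra F, is_free_resolution J F & is_minimal F].

(* Equality of the images of x and y in M (x) k = M / m M. *)
Definition eq_mod (M : lmodType R) (x y : M) : Prop :=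
  smul m [set: M] (x - y).

(* The images of the f i form a basis of the k-vector space M (x) k. *)
Definition is_residue_basis (M : lmodType R) (n : nat) (f : 'I_n -> M) : Prop :=
  (forall x, exists a : 'I_n -> R, eq_mod x (\sum_i a i *: f i)) /\
  (forall a : 'I_n -> R, eq_mod (\sum_i a i *: f i) 0 -> forall i, m (a i)).

(* The multiplication table of class G(r) in F (x) k. Indices start at 0, so
   f3 ord0 is the distinguished element of degree 3. *)
Definition G_table (F : dg_data R) (r n1 n2 n3 : nat) (f1 : 'I_n1 -> F1 F)
    (f2 : 'I_n2 -> F2 F) (f3 : 'I_n3.+1 -> F3 F) : Prop :=
  [/\ (r <= n1)%N, (r <= n2)%N,
      forall i j, eq_mod (mul11 F (f1 i) (f1 j)) 0 &
      forall i j, eq_mod (mul12 F (f1 i) (f2 j))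
        (if (i == j :> nat) && (i < r)%N then f3 ord0 else 0)].

(* R/J has class G(r). The algebra Tor^R(R/J, k) is F (x) k for a minimal
   DG-algebra resolution F of R/J, and does not depend on F up to isomorphism;
   Tor_3 is nonzero since R/J has projective dimension 3. *)
Definition class_G (J : set R) (r : nat) : Prop :=
  pd_quot_eq J 3 /\
  exists F : dg_data R, minimal_dg_resolution J F /\
  exists (n1 n2 n3 : nat) (f1 : 'I_n1 -> F1 F) (f2 : 'I_n2 -> F2 F)
         (f3 : 'I_n3.+1 -> F3 F),
    [/\ is_residue_basis f1, is_residue_basis f2, is_residue_basis f3 &
        G_table r f1 f2 f3].

Definition standard_form (F : dg_data R) (r n1 n2 n3 : nat)
    (f1 : 'I_n1 -> F1 F) (f2 : 'I_n2 -> F2 F) (f3 : 'I_n3.+1 -> F3 F) : Prop :=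
  [/\ is_basis f1, is_basis f2, is_basis f3 & G_table r f1 f2 f3].

Definition tm (n : nat) (phi : 'I_n -> R) (sigma : {set 'I_n}) : set R :=
  ideal_add (ideal_gen [set x | exists2 i, i \notin sigma & x = phi i])
    (ideal_mul m (ideal_gen [set x | exists2 j, j \in sigma & x = phi j])).

End DG.

(* Main.v *)
(** Let x = (x1, x2, x3) generate m and let K be the Koszul complex on x. Chasing
   the double complex formed by K and F shows that K is exact, because F is a
   minimal free resolution of length exactly 3; no dimension theory is needed.
   Replacing each trimmed generator f1_j by a copy of K, through comparison
   maps Q1 : F2 -> K1 and Q2 : F3 -> K2, gives a resolution T of R/tm(I) with a
   morphism T -> F. It is minimal because d_K y in m^2 K implies y in m K. The
   product of F1 x F1 lifts to T, and injectivity of d3 forces the remaining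
   products and all the DG identities. Modulo m the products T1 x T1 vanish, and
   T1 x T2 only sees the pairs (f1_i, f2_i) with i not trimmed: their product is
   f3_1 plus a correction in K3, the same for all i, which is absorbed in the
   distinguished basis element of degree 3. *)

Require Import Defs.
From HB Require Import structures.
From mathcomp Require Import all_boot all_algebra.
From mathcomp Require Import boolp classical_sets.
From mathcomp Require Import ring.
Set Implicit Arguments.
Unset Strict Implicit.
Unset Printing Implicit Defensive.
Import GRing.Theory.
Local Open Scope classical_set_scope.
Local Open Scope ring_scope.

(** * Bases *)

(** The exactness of K rests on the fact that every element of m acts on K by a null-homotopic map.
    A basis vector u of F3, which exists because the resolution has length exactly 3, has d3 u with
    entries in m; so a Koszul cycle tensored with u becomes a boundary after applying d3, and the
    chase through F then removes d3 by injectivity. Exactness of K in degree 1 in turn makes x1, x2,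
    x3 independent modulo m^2, which is the source of the minimality criterion. The two m^2
    hypotheses are its input: the one on d2 puts Q1, and then Q2, into m, and the one on products
    helps to put the Koszul part of the lifted product into m. For the latter, the differential of
    T1 must take values in m^2 as well. This is read off from d2 (f1_k f1_l) = phi_k f1_l - phi_l
    f1_k: a kept generator phi_k lies in m^2 as soon as some l is trimmed, and a trimmed one has
    been multiplied by m. *)

Section LinearEx.
Variables (R : comNzRingType) (U V : lmodType R).

(** The proof of linearity is an argument, so that the structure of linear map can be attached to
    any function proved linear. *)
Definition linear_fun (f : U -> V) (flin : linear f) : U -> V := f.

HB.instance Definition _ f flin :=
  GRing.isLinear.Build R U V *:%R (@linear_fun f flin) flin.

Lemma linear_ex (f : U -> V) : linear f -> exists g : {linear U -> V}, g =1 f.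
Proof. by move=> flin; exists (linear_fun flin). Qed.

End LinearEx.

Section Bases.
Variable R : comNzRingType.

(** Index sets are arbitrary finite types: direct sums and matrix modules then have bases indexed by
    sums and products, and ordinals return through an enumeration. *)
Definition basis_on (M : lmodType R) (J : finType) (e : J -> M) : Prop :=
  (forall x, exists a : J -> R, x = \sum_j a j *: e j) /\
  (forall a : J -> R, \sum_j a j *: e j = 0 -> forall j, a j = 0).

Lemma basis_on_coord (M : lmodType R) (J : finType) (e : J -> M) :
  basis_on e -> exists c : J -> M -> R,
    [/\ forall j a x y, c j (a *: x + y) = a * c j x + c j y,
        forall x, x = \sum_j c j x *: e j &
        forall j k, c j (e k) = (j == k)%:R].
Proof.
move=> [gen free]; have [c cE] := choice gen.
have uniq_c x a : x = \sum_j a j *: e j -> forall j, c x j = a j.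
  move=> xE j; apply/eqP; rewrite -subr_eq0; apply/eqP.
  apply: (free (fun j => c x j - a j)).
  under eq_bigr do rewrite scalerBl.
  by rewrite sumrB -cE -xE subrr.
exists (fun j x => c x j); split=> [j a x y|x|j k]; last 2 first.
- exact: cE.
- apply: (uniq_c _ (fun j => (j == k)%:R)).
  rewrite (bigD1 k) //= eqxx scale1r big1 ?addr0 // => i /negPf->.
  exact: scale0r.
apply: (uniq_c _ (fun j => a * c x j + c y j)).
under eq_bigr do rewrite scalerDl -scalerA.
by rewrite big_split /= -scaler_sumr -!cE.
Qed.

Lemma basis_on_ext (M N : lmodType R) (J : finType) (e : J -> M)
    (f g : {linear M -> N}) :
  basis_on e -> (forall j, f (e j) = g (e j)) -> f =1 g.
Proof.
move=> [gen _] fg x; have [a ->] := gen x.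
by rewrite !linear_sum; apply: eq_bigr => j _; rewrite !linearZ fg.
Qed.

Lemma basis_on_map (M N : lmodType R) (J : finType) (e : J -> M) (g : J -> N) :
  basis_on e -> exists h : {linear M -> N}, forall j, h (e j) = g j.
Proof.
move=> /basis_on_coord [c [cP _ ce]].
have lin : linear (fun x => \sum_j c j x *: g j).
  move=> a x y; rewrite scaler_sumr -big_split; apply: eq_bigr => j _ /=.
  by rewrite cP scalerDl scalerA.
have [h hE] := linear_ex lin.
exists h => k; rewrite hE (bigD1 k) //= ce eqxx scale1r big1 ?addr0 // => j.
by rewrite ce => /negPf ->; rewrite scale0r.
Qed.

Lemma basis_on_lift (M N K : lmodType R) (J : finType) (e : J -> M)
    (f : {linear M -> N}) (g : {linear K -> N}) :
  basis_on e -> (forall x, exists y, g y = f x) ->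
  exists h : {linear M -> K}, forall x, g (h x) = f x.
Proof.
move=> eb fg; have [y yE] := choice (fun j => fg (e j)).
have [h hE] := basis_on_map y eb.
by exists h; apply: (basis_on_ext (f := g \o h) eb) => j /=; rewrite hE.
Qed.

(** Ordering the indices lets the term at (i, j) cancel the one at (j, i). Antisymmetry alone would
    only show that twice the sum vanishes, which is weaker when 2 is a zero divisor. *)
Lemma sum_alternating (V : zmodType) (J : finType) (F : J -> J -> V) :
  (forall i, F i i = 0) -> (forall i j, F i j = - F j i) ->
  \sum_i \sum_j F i j = 0.
Proof.
move=> F0 FN.
have lt_rank (i j : J) : (enum_rank j < enum_rank i)%N =
    (i != j) && ~~ (enum_rank i < enum_rank j)%N.
  rewrite -leqNgt ltn_neqAle; congr (~~ _ && _).
  by rewrite eq_sym (inj_eq val_inj) (inj_eq enum_rank_inj).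
pose P (i j : J) := (enum_rank i < enum_rank j)%N.
have -> : \sum_i \sum_j F i j =
    \sum_i \sum_(j | P i j) F i j + \sum_i \sum_(j | P j i) F i j.
  rewrite -big_split; apply: eq_bigr => i _ /=.
  rewrite (bigID (P i)) /=; congr (_ + _).
  rewrite (bigD1 i) /=; last by rewrite /P ltnn.
  rewrite F0 add0r; apply: eq_bigl => j.
  by rewrite [in RHS]/P lt_rank eq_sym andbC.
rewrite [X in _ + X](exchange_big_dep predT) //= -big_split big1 //= => i _.
by rewrite -big_split big1 //= => j _; rewrite FN addNr.
Qed.

(* Alternation is arranged on the basis, since [g] need not be injective. *)
Lemma basis_on_alt_lift (M N K : lmodType R) (J : finType) (e : J -> M)
    (om : M -> M -> N) (g : {linear K -> N}) :
  basis_on e -> (forall x, linear (om x)) -> (forall y, linear (om^~ y)) ->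
  (forall x, om x x = 0) -> (forall x y, exists z, g z = om x y) ->
  exists w : M -> M -> K, [/\ forall x, linear (w x), forall y, linear (w^~ y),
    forall x, w x x = 0 & forall x y, g (w x y) = om x y].
Proof.
move=> eb omr oml om0 om_im; have [c [cP cE _]] := basis_on_coord eb.
have omN x y : om x y = - om y x.
  apply/eqP; rewrite -addr_eq0; have := om0 (x + y).
  have omD u v z : om z (u + v) = om z u + om z v.
    by have := omr z 1 u v; rewrite !scale1r.
  have omDl u v z : om (u + v) z = om u z + om v z.
    by have := oml z 1 u v; rewrite !scale1r.
  by rewrite omDl !omD !om0 add0r addr0 => ->.
have [z zE] := choice (fun ij : J * J => om_im (e ij.1) (e ij.2)).
pose q i j := if (enum_rank i < enum_rank j)%N then z (i, j) else
              if (enum_rank j < enum_rank i)%N then - z (j, i) else 0.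
have q0 i : q i i = 0 by rewrite /q ltnn.
have qN i j : q i j = - q j i.
  by rewrite /q; case: ltngtP => //; rewrite ?opprK ?oppr0.
have gq i j : g (q i j) = om (e i) (e j).
  rewrite /q; case: ltngtP => [_|_|/val_inj/enum_rank_inj ->].
  - by rewrite zE.
  - by rewrite linearN zE -omN.
  - by rewrite linear0 om0.
exists (fun x y => \sum_i \sum_j (c i x * c j y) *: q i j); split.
- move=> x a y y'; rewrite scaler_sumr -big_split; apply: eq_bigr => i _ /=.
  rewrite scaler_sumr -big_split; apply: eq_bigr => j _ /=.
  by rewrite cP mulrDr scalerDl scalerA; congr (_ *: _ + _); rewrite mulrCA.
- move=> y a x x'; rewrite scaler_sumr -big_split; apply: eq_bigr => i _ /=.
  rewrite scaler_sumr -big_split; apply: eq_bigr => j _ /=.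
  by rewrite cP mulrDl scalerDl scalerA; congr (_ *: _ + _); rewrite mulrA.
- move=> x; apply: sum_alternating => [i|i j]; first by rewrite q0 scaler0.
  by rewrite qN scalerN mulrC.
- move=> x y.
  have [fy fyE] := linear_ex (oml y).
  rewrite -(fyE x) [in RHS](cE x) !linear_sum; apply: eq_bigr => i _ /=.
  have [fi fiE] := linear_ex (omr (e i)).
  rewrite [RHS]linearZ /= fyE -fiE [in RHS](cE y) !linear_sum.
  by apply: eq_bigr => j _ /=; rewrite !linearZ /= gq fiE scalerA mulrC.
Qed.

Lemma is_basis_on (M : lmodType R) (n : nat) (f : 'I_n -> M) :
  is_basis f -> basis_on f.
Proof.
move=> fb; split=> [x|a a0 j].
  by have [a [-> _]] := fb x; exists (a 0).
have [b [_ bu]] := fb 0.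
have ba : b = \row_i a i.
  by apply: bu; under eq_bigr do rewrite mxE; rewrite a0.
have b0 : b = 0.
  by apply: bu; rewrite big1 // => i _; rewrite mxE scale0r.
by have := congr1 (fun v : 'rV_n => v 0 j) ba; rewrite b0 !mxE.
Qed.

Lemma basis_on_is (M : lmodType R) (J : finType) (e : J -> M) (n : nat)
    (g : 'I_n -> J) :
  basis_on e -> bijective g -> is_basis (e \o g).
Proof.
move=> [gen free] [h gK hK] x; have [a xE] := gen x.
have re (b : J -> R) : \sum_j b j *: e j = \sum_i b (g i) *: (e \o g) i.
  by rewrite (reindex g) //=; exists h => ? _.
exists (\row_i a (g i)); split=> [|b xb].
  by rewrite xE re; apply: eq_bigr => i _; rewrite mxE.
apply/rowP => i; rewrite mxE.
have /free/(_ (g i)) : \sum_j (a j - b 0 (h j)) *: e j = 0.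
  under eq_bigr do rewrite scalerBl.
  rewrite sumrB -xE re; under eq_bigr do rewrite gK.
  by rewrite -xb subrr.
by rewrite gK => /eqP; rewrite subr_eq0 => /eqP.
Qed.

Lemma basis_on_finite_free (M : lmodType R) (J : finType) (e : J -> M) :
  basis_on e -> finite_free M.
Proof.
move=> eb; exists #|J|, (e \o enum_val); apply: basis_on_is eb _.
by exists enum_rank; [exact: enum_valK | exact: enum_rankK].
Qed.

(** The shear [h] keeps the family triangular. A nonzero [h] serves to absorb the Koszul correction
    into the distinguished element of degree 3. *)
Lemma basis_on_pair (M N : lmodType R) (J K : finType) (e : J -> M)
    (h : J -> N) (e' : K -> N) :
  basis_on e -> basis_on e' ->
  basis_on (fun jk : J + K =>
    match jk with inl j => (e j, h j) | inr k => (0, e' k) end).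
Proof.
move=> [gen free] [gen' free'].
have sumE (a : J + K -> R) :
    \sum_jk a jk *: match jk with inl j => (e j, h j) | inr k => (0, e' k) end
    = (\sum_j a (inl j) *: e j,
       \sum_j a (inl j) *: h j + \sum_k a (inr k) *: e' k).
  rewrite big_sumType /=.
  have -> : \sum_j a (inl j) *: (e j, h j) =
            (\sum_j a (inl j) *: e j, \sum_j a (inl j) *: h j).
    by elim/big_rec3: _ => // j y1 y2 y3 _ ->.
  have -> : \sum_k a (inr k) *: ((0, e' k) : M * N) =
            (0, \sum_k a (inr k) *: e' k).
    by elim/big_rec2: _ => // k y1 y2 _ ->; congr pair; rewrite /= scaler0 addr0.
  by congr pair; rewrite /= addr0.
split=> [[x y]|a].
  have [a ->] := gen x; have [b bE] := gen' (y - \sum_j a j *: h j).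
  exists (fun jk => match jk with inl j => a j | inr k => b k end).
  by rewrite sumE -bE addrC subrK.
rewrite sumE => -[/free a0].
rewrite big1 => [|j _]; last by rewrite a0 scale0r.
by rewrite add0r => /free' b0 [j|k].
Qed.

Lemma basis_on_delta_mx (p q : nat) :
  basis_on (fun ij : 'I_p * 'I_q => delta_mx ij.1 ij.2 : 'M[R]_(p, q)).
Proof.
have sumE (a : 'I_p * 'I_q -> R) :
    \sum_ij a ij *: delta_mx ij.1 ij.2 = \matrix_(i, j) a (i, j).
  rewrite [RHS]matrix_sum_delta pair_bigA /=.
  by apply: eq_bigr => -[i j] _; rewrite mxE.
split=> [A|a].
  exists (fun ij => A ij.1 ij.2); rewrite sumE; apply/matrixP=> i j.
  by rewrite mxE.
by rewrite sumE => /matrixP a0 [i j]; have := a0 i j; rewrite !mxE.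
Qed.

End Bases.

(** * Enumerations that put a chosen family first *)

Section PrefixEnum.

Lemma prefix_enum (J : finType) (s : seq J) (N : nat) :
  uniq s -> N = #|J| ->
  (size s <= N)%N /\ exists g : 'I_N -> J, bijective g /\
    forall j0 (k : 'I_N), (k < size s)%N -> g k = nth j0 s k.
Proof.
move=> us ->; pose t := s ++ [seq j <- enum J | j \notin s].
have ut : uniq t.
  rewrite cat_uniq us filter_uniq ?enum_uniq // andbT.
  by apply/hasPn => j; rewrite mem_filter => /andP[].
have tj j : j \in t.
  by rewrite mem_cat mem_filter mem_enum andbT; case: (j \in s).
have st : size t = #|J|.
  rewrite cardE; apply/eqP; rewrite -uniq_size_uniq ?enum_uniq // => j.
  by rewrite tj mem_enum.
split; first by rewrite -st size_cat leq_addr.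
exists (fun k : 'I_#|J| => tnth (in_tuple t) (cast_ord (esym st) k)).
split; last by move=> j0 k ks; rewrite (tnth_nth j0) nth_cat ks.
have lt j : (index j t < #|J|)%N by rewrite -st index_mem.
exists (fun j => Ordinal (lt j)) => [k|j]; last by rewrite (tnth_nth j) nth_index.
apply: val_inj => /=.
by rewrite (tnth_nth (tnth (in_tuple t) (cast_ord (esym st) k))) index_uniq ?st.
Qed.

(* A partial bijection between two finite index sets becomes the identity of
   an initial segment after enumerating both sets. *)
Lemma prefix_enum_rel (J1 J2 : finType) (rel : J1 -> J2 -> bool) (N1 N2 : nat) :
  (forall a b b', rel a b -> rel a b' -> b = b') ->
  (forall a a' b, rel a b -> rel a' b -> a = a') ->
  N1 = #|J1| -> N2 = #|J2| ->
  let r := #|[pred ab : J1 * J2 | rel ab.1 ab.2]| in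
  [/\ (r <= N1)%N, (r <= N2)%N & exists (g1 : 'I_N1 -> J1) (g2 : 'I_N2 -> J2),
    [/\ bijective g1, bijective g2 &
      forall i j, rel (g1 i) (g2 j) = (i == j :> nat) && (i < r)%N]].
Proof.
move=> rel1 rel2 N1E N2E r.
pose s := enum [pred ab : J1 * J2 | rel ab.1 ab.2].
have sz : size s = r by rewrite -cardE.
have inS a b : ((a, b) \in s) = rel a b by rewrite mem_enum inE.
have u1 : uniq (map fst s).
  rewrite map_inj_in_uniq ?enum_uniq // => -[a b] [a' b'].
  by rewrite !inS /= => ab + aa'; rewrite -aa' => /rel1 /(_ ab) <-.
have u2 : uniq (map snd s).
  rewrite map_inj_in_uniq ?enum_uniq // => -[a b] [a' b'].
  by rewrite !inS /= => ab + bb'; rewrite -bb' => /rel2 /(_ ab) <-.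
have [] := prefix_enum u1 N1E; rewrite size_map sz => le1 [g1 [g1b g1E]].
have [] := prefix_enum u2 N2E; rewrite size_map sz => le2 [g2 [g2b g2E]].
split=> //; exists g1, g2; split=> // i j.
pose j1 := g1 i; pose j2 := g2 j; apply/idP/idP.
  rewrite -inS => /[dup] + /(nthP (j1, j2)) [k]; rewrite sz => _ ks kE.
  have k1 : Ordinal (leq_trans ks le1) = i.
    by apply: (bij_inj g1b); rewrite (g1E j1) // (nth_map (j1, j2)) ?sz // kE.
  have k2 : Ordinal (leq_trans ks le2) = j.
    by apply: (bij_inj g2b); rewrite (g2E j2) // (nth_map (j1, j2)) ?sz // kE.
  by rewrite -k1 -k2 /= eqxx.
move=> /andP[/eqP ij ir]; have jr : (j < r)%N by rewrite -ij.
rewrite (g1E j1) // (g2E j2) // -ij !(nth_map (j1, j2)) ?sz // -inS -surjective_pairing.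
by rewrite mem_nth ?sz.
Qed.

End PrefixEnum.

(** * Submodules J M *)

Section IdealMultiples.
Variable R : comNzRingType.
Implicit Types (J K : set R) (M N : lmodType R).

Lemma smul0 M J (V : set M) : smul J V 0.
Proof.
exists 0%N, (fun=> 0), (fun=> 0); split=> [[]|[]|] //.
by rewrite big_ord0.
Qed.

Lemma smulD M J (V : set M) x y : smul J V x -> smul J V y -> smul J V (x + y).
Proof.
move=> [k [a [v [Ja Vv ->]]]] [l [b [w [Jb Vw ->]]]].
exists (k + l)%N, (fun i => match split i with inl i => a i | inr i => b i end),
  (fun i => match split i with inl i => v i | inr i => w i end); split.
- by move=> i; case: (split i).
- by move=> i; case: (split i).
rewrite big_split_ord; congr (_ + _); apply: eq_bigr => i _.
  by rewrite (unsplitK (inl i)).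
by rewrite (unsplitK (inr i)).
Qed.

Lemma smul_gen M J (V : set M) a v : J a -> V v -> smul J V (a *: v).
Proof.
move=> Ja Vv; exists 1%N, (fun=> a), (fun=> v); split=> //.
by rewrite big_ord1.
Qed.

Lemma smul_ind M J (V : set M) (P : M -> Prop) :
  P 0 -> (forall x y, P x -> P y -> P (x + y)) ->
  (forall a v, J a -> V v -> P (a *: v)) -> forall x, smul J V x -> P x.
Proof.
move=> P0 PD PZ x [k [a [v [Ja Vv ->]]]].
by elim/big_ind: _ => // i _; apply: PZ.
Qed.

Lemma smulZ M J b (x : M) : smul J [set: M] x -> smul J [set: M] (b *: x).
Proof.
move: x; apply: smul_ind => [|x y|a v Ja _].
- by rewrite scaler0; apply: smul0.
- by rewrite scalerDr; apply: smulD.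
- by rewrite scalerA mulrC -scalerA; apply: smul_gen.
Qed.

Lemma smulN M J (x : M) : smul J [set: M] x -> smul J [set: M] (- x).
Proof. by rewrite -scaleN1r; apply: smulZ. Qed.

Lemma smulB M J (x y : M) :
  smul J [set: M] x -> smul J [set: M] y -> smul J [set: M] (x - y).
Proof. by move=> Jx /smulN; apply: smulD. Qed.

Lemma smul_mono M J K (x : M) :
  J `<=` K -> smul J [set: M] x -> smul K [set: M] x.
Proof.
move=> JK; move: x; apply: smul_ind; [exact: smul0|move=> x y; exact: smulD|].
by move=> a v /JK Ka _; apply: smul_gen.
Qed.

Lemma smul_lin M N J (f : {linear M -> N}) x :
  smul J [set: M] x -> smul J [set: N] (f x).
Proof.
move: x; apply: smul_ind; first by rewrite linear0; apply: smul0.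
  by move=> x y; rewrite linearD; apply: smulD.
by move=> a v Ja _; rewrite linearZ; apply: smul_gen.
Qed.

(** This is how two successive factors in m, such as a differential followed by a comparison map,
    add up to m^2. *)
Lemma smul_lin_mul M N J K (f : {linear M -> N}) x :
  (forall y, smul K [set: N] (f y)) ->
  smul J [set: M] x -> smul (ideal_mul J K) [set: N] (f x).
Proof.
move=> Kf; move: x; apply: smul_ind; first by rewrite linear0; apply: smul0.
  by move=> x y; rewrite linearD; apply: smulD.
move=> a v Ja _; rewrite linearZ /=; move: (f v) (Kf v); apply: smul_ind.
- by rewrite scaler0; apply: smul0.
- by move=> x y; rewrite scalerDr; apply: smulD.
- by move=> b w Kb _; rewrite scalerA; apply: smul_gen => //; apply: (@smul_gen R^o).
Qed.

Lemma ideal_sum J (I : finType) (P : pred I) (a : I -> R) :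
  is_ideal J -> (forall i, J (a i)) -> J (\sum_(i | P i) a i).
Proof. by move=> [J0 JD _] Ja; elim/big_ind: _. Qed.

Lemma ideal_mulP J K : is_ideal J -> is_ideal (ideal_mul J K).
Proof.
move=> [_ _ JM]; split.
- exact: (@smul0 R^o).
- by move=> x y; apply: (@smulD R^o).
move=> a x; move: x; apply: (@smul_ind R^o).
- by rewrite mulr0; apply: (@smul0 R^o).
- by move=> x y; rewrite mulrDr; apply: (@smulD R^o).
move=> b v Jb Kv; rewrite -[a * _]/(a *: (b *: (v : R^o))) scalerA.
by apply: (@smul_gen R^o) => //; apply: JM.
Qed.

Lemma ideal_mul_subr J K : is_ideal K -> ideal_mul J K `<=` K.
Proof.
move=> [K0 KD KM]; apply: (@smul_ind R^o) => // a v _ Kv; exact: KM.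
Qed.

Lemma smul_regular J (a : R) : is_ideal J -> smul J [set: R^o] a <-> J a.
Proof.
move=> [J0 JD JM]; split.
  by apply: (@smul_ind R^o) => // b c Jb _; rewrite -[b *: c]mulrC; apply: JM.
by move=> Ja; rewrite -[a]mulr1; apply: (@smul_gen R^o).
Qed.

Lemma smul_mx J p q (A : 'M[R]_(p, q)) : is_ideal J ->
  smul J [set: 'M[R]_(p, q)] A <-> forall i j, J (A i j).
Proof.
move=> [J0 JD JM]; split.
  move: A; apply: smul_ind => [i j|A B JA JB i j|a B Ja _ i j]; rewrite mxE //.
    exact: JD.
  by rewrite mulrC; apply: JM.
move=> JA; rewrite (matrix_sum_delta A).
elim/big_ind: _ => [|x y|i _]; [exact: smul0|exact: smulD|].
elim/big_ind: _ => [|x y|j _]; [exact: smul0|exact: smulD|].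
by apply: smul_gen.
Qed.

Lemma smul_basis M J (I : finType) (e : I -> M) (a : I -> R) :
  is_ideal J -> basis_on e -> smul J [set: M] (\sum_i a i *: e i) ->
  forall i, J (a i).
Proof.
move=> Jid eb Ja i.
have [h hE] := basis_on_map (fun i => delta_mx 0 (enum_rank i) : 'rV[R]_#|I|) eb.
have := smul_lin h Ja; rewrite (smul_mx _ Jid) => /(_ 0 (enum_rank i)).
rewrite linear_sum summxE (bigD1 i) //= linearZ hE !mxE !eqxx mulr1.
rewrite big1 ?addr0 // => k ki.
by rewrite linearZ hE !mxE (inj_eq enum_rank_inj) eq_sym (negPf ki) mulr0.
Qed.

Lemma smul_pair M N J (x : M) (y : N) :
  smul J [set: M] x -> smul J [set: N] y -> smul J [set: (M * N)%type] (x, y).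
Proof.
move=> Jx Jy; have -> : (x, y) = (x, 0) + (0, y).
  by congr pair; rewrite /= ?addr0 ?add0r.
apply: smulD; [move: x Jx|move: y Jy]; apply: smul_ind; try exact: smul0.
- move=> u u' ? ?; have -> : (u + u', 0 : N) = (u, 0) + (u', 0).
    by congr pair; rewrite /= addr0.
  exact: smulD.
- move=> a v Ja _; have -> : (a *: v, 0 : N) = a *: (v, 0).
    by congr pair; rewrite /= scaler0.
  exact: smul_gen.
- move=> u u' ? ?; have -> : (0 : M, u + u') = (0, u) + (0, u').
    by congr pair; rewrite /= addr0.
  exact: smulD.
- move=> a v Ja _; have -> : (0 : M, a *: v) = a *: (0, v).
    by congr pair; rewrite /= scaler0.
  exact: smul_gen.
Qed.

Lemma basis_on_residue M J (I : finType) (e : I -> M) n (g : 'I_n -> I) :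
  is_ideal J -> basis_on e -> bijective g -> is_residue_basis J (e \o g).
Proof.
move=> Jid eb gb.
have geb := is_basis_on (basis_on_is eb gb).
split=> [x|a].
  have [a xE] := geb.1 x; exists a.
  by rewrite /eq_mod xE subrr; apply: smul0.
by rewrite /eq_mod subr0; apply: smul_basis.
Qed.

End IdealMultiples.

(** * Projective dimension of a module with a minimal resolution of length 3 *)

Section ImageModule.
Variables (R : comNzRingType) (M N : lmodType R) (g : {linear M -> N}).

Definition in_image : pred N := fun y => `[< exists x, g x = y >].

Lemma in_image_closed : submod_closed in_image.
Proof.
split=> [|a y z]; first by apply/asboolP; exists 0; rewrite linear0.
move=> /asboolP[x <-] /asboolP[x' <-]; apply/asboolP.
by exists (a *: x + x'); rewrite linearP.
Qed.

HB.instance Definition _ := GRing.isSubmodClosed.Build R N in_image in_image_closed.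

Record image_mod := ImageMod { image_val : N; _ : image_val \in in_image }.

HB.instance Definition _ := [isSub for image_val].
HB.instance Definition _ := [Choice of image_mod by <:].
HB.instance Definition _ := [SubChoice_isSubLmodule of image_mod by <:].

(** The definition of [projective] lifts along surjections only. Corestricting [g] to its image,
    made into a module, extends this to every [f] with values in that image. *)
Lemma projective_lift (P : lmodType R) (f : {linear P -> N}) :
  projective P -> (forall p, exists x, g x = f p) ->
  exists h : {linear P -> M}, forall p, g (h p) = f p.
Proof.
move=> Pproj fg.
have gI x : g x \in in_image by apply/asboolP; exists x.
have fI p : f p \in in_image by apply/asboolP.
have glin : linear (fun x => ImageMod (gI x)).
  by move=> a x y; apply: val_inj; rewrite /= linearP.
have flin : linear (fun p => ImageMod (fI p)).
  by move=> a x y; apply: val_inj; rewrite /= linearP.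
have [g' g'E] := linear_ex glin; have [f' f'E] := linear_ex flin.
have g's : surj g'.
  move=> [y yI]; have /asboolP [x xy] := yI.
  by exists x; apply: val_inj; rewrite g'E.
have [h hE] := Pproj _ _ _ f' g's; exists h => p.
by have /(congr1 val) := hE p; rewrite g'E f'E.
Qed.

End ImageModule.

Lemma basis_on_projective (R : comNzRingType) (P : lmodType R) (J : finType)
  (e : J -> P) : basis_on e -> projective P.
Proof. by move=> eb M N g f gs; apply: basis_on_lift eb _ => x; apply: gs. Qed.

Lemma regular_projective (R : comNzRingType) : projective (R^o : lmodType R).
Proof.
apply: (@basis_on_projective _ _ 'I_1 (fun=> 1)); split=> [x|a a0 j].
  by exists (fun=> x); rewrite big_ord1 /GRing.scale /= mulr1.
by move: a0; rewrite big_ord1 /GRing.scale /= mulr1 (ord1 j).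
Qed.

Section QuotientModule.
Local Open Scope quotient_scope.
Variables (R : comNzRingType) (J : set R).

(** The proof [Jid] is carried by the predicate so that its closure properties can be inferred from
    it. *)
Definition in_ideal (Jid : is_ideal J) : pred R := fun x => `[< J x >].

Variable Jid : is_ideal J.

Lemma in_ideal_closed : zmod_closed (in_ideal Jid).
Proof.
have [J0 JD JM] := Jid; split=> [|x y]; first exact/asboolP.
move=> /asboolP Jx /asboolP Jy; apply/asboolP; apply: JD => //.
by rewrite -mulN1r; apply: JM.
Qed.

HB.instance Definition _ := GRing.isZmodClosed.Build R (in_ideal Jid) in_ideal_closed.

Definition ideal_zmod : zmodClosed R :=
  GRing.ZmodClosed.clone R (in_ideal Jid) _.

Definition quot_mod := @Quotient.quot R ideal_zmod.

HB.instance Definition _ := GRing.Zmodule.on quot_mod.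

Definition to_quot (x : R) : quot_mod := \pi_(@Quotient.quot R ideal_zmod) x.

Lemma to_quotD x y : to_quot (x + y) = to_quot x + to_quot y.
Proof. exact: (raddfD (\pi_(@Quotient.quot R ideal_zmod))). Qed.

Lemma to_quot_eq x y : to_quot x = to_quot y <-> J (x - y).
Proof.
split=> [/eqP|Jxy]; first by rewrite -Quotient.idealrBE => /asboolP.
by apply/eqP; rewrite -Quotient.idealrBE; apply/asboolP.
Qed.

Lemma to_quot_repr (u : quot_mod) : to_quot (repr u) = u.
Proof. exact: reprK. Qed.

Definition quot_scale (a : R) (u : quot_mod) : quot_mod := to_quot (a * repr u).

Lemma quot_scaleE a x : quot_scale a (to_quot x) = to_quot (a * x).
Proof.
apply/to_quot_eq; rewrite -mulrBr; have [_ _] := Jid; apply.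
by apply/to_quot_eq; rewrite to_quot_repr.
Qed.

Lemma quot_scaleA a b u : quot_scale a (quot_scale b u) = quot_scale (a * b) u.
Proof. by rewrite -(to_quot_repr u) !quot_scaleE mulrA. Qed.

Lemma quot_scale1 : left_id 1 quot_scale.
Proof. by move=> u; rewrite -(to_quot_repr u) quot_scaleE mul1r. Qed.

Lemma quot_scaleDr : right_distributive quot_scale +%R.
Proof.
move=> a u v; rewrite -(to_quot_repr u) -(to_quot_repr v).
by rewrite -to_quotD !quot_scaleE mulrDr to_quotD.
Qed.

Lemma quot_scaleDl u : {morph quot_scale^~ u : a b / a + b}.
Proof.
by move=> a b; rewrite -(to_quot_repr u) !quot_scaleE mulrDl to_quotD.
Qed.

HB.instance Definition _ := GRing.Zmodule_isLmodule.Build R quot_mod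
  quot_scaleA quot_scale1 quot_scaleDr quot_scaleDl.

(** Supplies the model of R/J that [pd_quot_eq] asks for; scalars act through representatives, which
    is well defined because [J] absorbs multiplication. *)
Lemma quotient_module : exists (M : lmodType R) (pi : {linear R^o -> M}),
  surj pi /\ forall x, pi x = 0 <-> J x.
Proof.
have lin : linear (to_quot : R^o -> quot_mod).
  by move=> a x y; rewrite to_quotD; congr (_ + _); apply: esym; exact: quot_scaleE.
have [pi piE] := linear_ex lin; exists quot_mod, pi; split=> [u|x].
  by exists (repr u); rewrite piE to_quot_repr.
rewrite piE; have <- : to_quot 0 = 0.
  by apply: (addrI (to_quot 0)); rewrite -to_quotD !addr0.
by rewrite to_quot_eq subr0.
Qed.

End QuotientModule.

Section MinimalResolution.
Variables (R : comNzRingType) (m J : set R) (F : dg_data R).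
Hypotheses (mid : is_ideal m) (m1 : ~ m 1).
Hypothesis Fres : is_free_resolution J F.
Hypothesis Fmin : forall u : F3 F, smul m [set: F2 F] (d3 F u).

Lemma resolved_ideal : is_ideal J.
Proof.
have [_ [JE _ _ _]] := Fres; split=> [|x y|a x]; rewrite !JE.
- by exists 0; rewrite linear0.
- by move=> [u <-] [v <-]; exists (u + v); rewrite linearD.
- by move=> [u <-]; exists (a *: u); rewrite linearZ.
Qed.

Lemma finite_free_basis (M : lmodType R) :
  finite_free M -> exists n (e : 'I_n -> M), basis_on e.
Proof. by move=> [n [e /is_basis_on eb]]; exists n, e. Qed.

(** The resolutions in [pd_le] are indexed by all naturals, so degrees above 3 are filled with the
    zero module of row vectors of length 0. *)
Definition res_mod (i : nat) : lmodType R :=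
  match i with
  | 0 => R^o | 1 => F1 F | 2 => F2 F | 3 => F3 F | _ => 'rV[R]_0
  end.

Definition res_diff (i : nat) : {linear res_mod i.+1 -> res_mod i} :=
  match i with
  | 0 => d1 F | 1 => d2 F | 2 => d3 F
  | 3 => (\0 : 'rV[R]_0 -> F3 F)
  | _ => (\0 : 'rV[R]_0 -> 'rV[R]_0)
  end.

Lemma pd_le_resolution (M : lmodType R) (pi : {linear R^o -> M}) :
  surj pi -> (forall x, pi x = 0 <-> J x) -> pd_le M 3.
Proof.
move=> pis piE; have [[F1f F2f F3f] [JE ex1 ex2 inj3]] := Fres.
have proj (N : lmodType R) : finite_free N -> projective N.
  by move=> /finite_free_basis [n [e]]; apply: basis_on_projective.
have proj0 : projective ('rV[R]_0 : lmodType R).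
  by apply: basis_on_projective (basis_on_delta_mx R 1 0).
have projR := @regular_projective R.
exists res_mod, pi, res_diff; split=> //.
- by move=> [|[|[|[|i]]]] //=; apply: proj.
- by move=> x; rewrite piE; exact: JE.
- move=> [|[|[|i]]]; [exact: ex1|exact: ex2|move=> x|move=> x]; split.
  + move=> x0; exists 0; rewrite linear0; apply: inj3.
    by rewrite linear0; apply: esym.
  + by move=> [y <-]; rewrite /= linear0.
  + by move=> _; exists 0; rewrite linear0; exact: esym (thinmx0 x).
  + by case: i x.
- by move=> [|[|[|[|i]]]] //= _ x; exact: thinmx0 x.
Qed.

(* Comparing [F] with a projective resolution of length at most 2 contracts
   the identity of [F] in degree 3: [u = h2 (d3 u)] for all [u]. *)
Lemma minimal_pd_ge (M : lmodType R) (pi : {linear R^o -> M}) (n3 : nat)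
    (f3 : 'I_n3.+1 -> F3 F) e :
  surj pi -> (forall x, pi x = 0 <-> J x) -> basis_on f3 -> pd_le M e ->
  (3 <= e)%N.
Proof.
move=> pis piE f3b [P [eps [f [Pproj epss ex0 exS P0]]]].
rewrite leqNgt; apply/negP => /P0 P3.
have [[/finite_free_basis [n1 [e1 e1b]] /finite_free_basis [n2 [e2 e2b]] _]
  [JE ex1 ex2 inj3]] := Fres.
have pif x : eps (f 0%N x) = 0 by apply/ex0; exists x.
have ff i x : f i (f i.+1 x) = 0 by apply/exS; exists x.
have d12 z : d1 F (d2 F z) = 0 by apply/ex1; exists z.
have d23 z : d2 F (d3 F z) = 0 by apply/ex2; exists z.
have [p1 p1E] := epss (pi 1).
have [b0 b0E] : exists b0 : {linear R^o -> P 0%N}, forall x, eps (b0 x) = pi x.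
  have lin : linear (fun x : R^o => (x : R) *: p1).
    by move=> a x y; rewrite scalerDl scalerA.
  have [b0 b0E] := linear_ex lin; exists b0 => x.
  by rewrite b0E linearZ /= p1E -linearZ /GRing.scale /= mulr1.
have [b1 b1E] : exists b1 : {linear F1 F -> P 1%N},
    forall x, f 0%N (b1 x) = b0 (d1 F x).
  apply: (basis_on_lift (f := b0 \o d1 F) e1b) => x /=.
  by apply/ex0; rewrite b0E; apply/piE/JE; exists x.
have [b2 b2E] : exists b2 : {linear F2 F -> P 2},
    forall x, f 1%N (b2 x) = b1 (d2 F x).
  apply: (basis_on_lift (f := b1 \o d2 F) e2b) => x /=.
  by apply/exS; rewrite b1E d12 linear0.
have [a0 a0E] : exists a0 : {linear P 0%N -> R^o}, forall x, pi (a0 x) = eps x.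
  by apply: projective_lift (Pproj _) _ => p; apply: pis.
have [a1 a1E] : exists a1 : {linear P 1%N -> F1 F},
    forall x, d1 F (a1 x) = a0 (f 0%N x).
  apply: (projective_lift (f := a0 \o f 0%N) (Pproj _)) => p /=.
  by apply/JE/piE; rewrite a0E pif.
have [a2 a2E] : exists a2 : {linear P 2 -> F2 F},
    forall x, d2 F (a2 x) = a1 (f 1%N x).
  apply: (projective_lift (f := a1 \o f 1%N) (Pproj _)) => p /=.
  by apply/ex1; rewrite a1E ff linear0.
(* [h0], [h1], [h2] form a homotopy between the identity of [F] and the composite of the comparison
   maps [b] and [a]. *)
have [h0 h0E] : exists h0 : {linear R^o -> F1 F},
    forall x, d1 F (h0 x) = x - a0 (b0 x).
  apply: (projective_lift (f := (idfun \- (a0 \o b0))%R)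
    (@regular_projective R)) => x /=.
  by apply/JE/piE; rewrite linearB /= a0E b0E subrr.
have [h1 h1E] : exists h1 : {linear F1 F -> F2 F},
    forall x, d2 F (h1 x) = x - a1 (b1 x) - h0 (d1 F x).
  apply: (basis_on_lift (f := (idfun \- (a1 \o b1) \- (h0 \o d1 F))%R) e1b) => x /=.
  by apply/ex1; rewrite !linearB /= h0E a1E b1E subrr.
have [h2 h2E] : exists h2 : {linear F2 F -> F3 F},
    forall x, d3 F (h2 x) = x - a2 (b2 x) - h1 (d2 F x).
  apply: (basis_on_lift (f := (idfun \- (a2 \o b2) \- (h1 \o d2 F))%R) e2b) => x /=.
  by apply/ex2; rewrite !linearB /= h1E a2E b2E d12 linear0 subr0 subrr.
(* This element is a cycle in [P 2], hence comes from [P 3], which is zero because 3 exceeds the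
   assumed length. *)
have b2d3 u : b2 (d3 F u) = 0.
  have /exS [p <-] : f 1%N (b2 (d3 F u)) = 0 by rewrite b2E d23 linear0.
  by rewrite (P3 p) linear0.
have h2d3 u : h2 (d3 F u) = u.
  by apply: inj3; rewrite h2E b2d3 d23 !(linear0, addr0).
(* By [h2d3] and minimality of [d3], a basis vector lies in m F3; reading its own coordinate puts 1
   in m. *)
have : smul m [set: F3 F] (f3 ord0).
  by rewrite -[f3 ord0]h2d3; apply: smul_lin.
rewrite -[f3 ord0]scale1r => mf3.
suff /(_ ord0) : forall j : 'I_n3.+1, m (j == ord0)%:R by rewrite eqxx => /m1.
apply: (smul_basis mid f3b); rewrite (bigD1 ord0) //= big1 ?addr0 //.
by move=> i /negPf ->; apply: scale0r.
Qed.

Lemma minimal_pd_quot (n3 : nat) (f3 : 'I_n3.+1 -> F3 F) :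
  basis_on f3 -> pd_quot_eq J 3.
Proof.
move=> f3b; have [M [pi [pis piE]]] := quotient_module resolved_ideal.
exists M, pi; split=> //; split; first exact: pd_le_resolution pis piE.
by move=> e; apply: minimal_pd_ge pis piE f3b.
Qed.

End MinimalResolution.

(** * DG structures and the Koszul complex on three elements *)

Section DGCompletion.
Variables (R : comNzRingType) (T1 T2 T3 : lmodType R).
Variables (e1 : {linear T1 -> R^o}) (e2 : {linear T2 -> T1}).
Variables (e3 : {linear T3 -> T2}) (mul : T1 -> T1 -> T2).
Hypotheses (mulr : forall x, linear (mul x)) (mull : forall y, linear (mul^~ y)).
Hypothesis mul0 : forall x, mul x x = 0.
Hypothesis leib : forall x y, e2 (mul x y) = (e1 x : R) *: y - (e1 y : R) *: x.
Hypotheses (e12 : forall z, e1 (e2 z) = 0) (e23 : exact e3 e2).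
Hypothesis e3inj : injective e3.

(* Since [e3] is injective, the product in degree 3 and all its identities are
   forced by the Leibniz rule. *)
Lemma dg_completion :
  exists mul' : T1 -> T2 -> T3, is_dg_algebra (DGData e1 e2 e3 mul mul').
Proof.
have e23_0 u : e2 (e3 u) = 0 by apply/e23; exists u.
have lift x z : exists u, e3 u = (e1 x : R) *: z - mul x (e2 z).
  by apply/e23; rewrite linearB linearZ /= leib e12 scale0r subr0 subrr.
have [mul' mul'E] := choice (fun xz : T1 * T2 => lift xz.1 xz.2).
have {}mul'E x z : e3 (mul' (x, z)) = (e1 x : R) *: z - mul x (e2 z).
  exact: mul'E (x, z).
have mulDr x y z : mul x (y + z) = mul x y + mul x z.
  by have := mulr x 1 y z; rewrite !scale1r.
have mulZr x a z : mul x (a *: z) = a *: mul x z.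
  have mx0 : mul x 0 = 0.
    by apply: (addrI (mul x 0)); rewrite -mulDr !addr0.
  by have := mulr x a z 0; rewrite mx0 !addr0.
have mulDl x y z : mul (y + z) x = mul y x + mul z x.
  by have := mull x 1 y z; rewrite !scale1r.
have mulN x y : mul x y = - mul y x.
  apply/eqP; rewrite -addr_eq0; have := mul0 (x + y).
  by rewrite mulDl !mulDr !mul0 add0r addr0 => ->.
have mulNr x y : mul x (- y) = - mul x y.
  by rewrite -scaleN1r mulZr scaleN1r.
have mulx0 x : mul x 0 = 0 by rewrite -(scale0r 0) mulZr scale0r.
exists (fun x z => mul' (x, z)); split=> //=.
- move=> x a z z'; apply: e3inj; rewrite mul'E [in RHS]linearP !mul'E.
  rewrite [e2 _]linearP mulDr mulZr !scalerDr !scalerA [a * _]mulrC scalerN.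
  by rewrite opprD addrACA.
- move=> z a x x'; apply: e3inj; rewrite mul'E [in RHS]linearP !mul'E.
  rewrite (mull (e2 z) a x x') [e1 _]linearP scalerDl scalerDr -!scalerA scalerN.
  by rewrite opprD addrACA.
- move=> x y z; apply: e3inj; rewrite !mul'E !leib.
  rewrite !mulDr !mulNr !mulZr (mulN z x) (mulN z y) !scalerN !opprK !opprD !opprK.
  by rewrite addrA addrC.
- move=> z w; apply: e3inj; rewrite linearD linear0 !mul'E !e12 !scale0r !sub0r.
  by rewrite [mul (e2 w) _]mulN opprK addNr.
- move=> x u; apply: e3inj; rewrite linearB linear0 linearZ /= mul'E e23_0.
  by rewrite mulx0 subr0 subrr.
Qed.

End DGCompletion.

Section Koszul.
Variable R : comNzRingType.

(* Right multiplication by [skew a] is the cross product with [a]. *)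
Definition skew (a : 'rV[R]_3) : 'M[R]_3 :=
  \matrix_(i, j) if i == j + 2%:R then a 0 (j + 1)
                 else if i == j + 1 then - a 0 (j + 2%:R) else 0.

Lemma ord3P (P : 'I_3 -> Prop) : P 0 -> P 1 -> P 2%:R -> forall i, P i.
Proof.
move=> P0 P1 P2 [[|[|[|//]]] lti].
- by rewrite (_ : Ordinal lti = 0) //; apply: val_inj.
- by rewrite (_ : Ordinal lti = 1) //; apply: val_inj.
- by rewrite (_ : Ordinal lti = 2%:R) //; apply: val_inj.
Qed.

Lemma sum3E (V : nmodType) (G : 'I_3 -> V) : \sum_i G i = G 0 + G 1 + G 2%:R.
Proof.
rewrite !big_ord_recl big_ord0 addr0 addrA; congr (_ + G _ + G _); exact: val_inj.
Qed.

Lemma ord3D :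
  (((0 + 1)%R = (1)%R :> 'I_3) *
   ((1 + 1)%R = (2%:R)%R :> 'I_3) *
   ((2%:R + 1)%R = (0)%R :> 'I_3) *
   ((0 + 2%:R)%R = (2%:R)%R :> 'I_3) *
   ((1 + 2%:R)%R = (0)%R :> 'I_3) *
   ((2%:R + 2%:R)%R = (1)%R :> 'I_3))%type.
Proof. by do !split; apply: val_inj. Qed.

Lemma ord3_eq :
  ((((0 : 'I_3) == 1)%R = false) *
   (((0 : 'I_3) == 2%:R)%R = false) *
   (((1 : 'I_3) == 0)%R = false) *
   (((1 : 'I_3) == 2%:R)%R = false) *
   (((2%:R : 'I_3) == 0)%R = false) *
   (((2%:R : 'I_3) == 1)%R = false))%type.
Proof. by []. Qed.

Lemma mul_skew_tr a : skew a *m a^T = 0.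
Proof.
apply/matrixP => i j; rewrite ord1 {j} !mxE sum3E !mxE.
by elim/ord3P: i; rewrite !(ord3D, ord3_eq, eqxx); ring.
Qed.

Lemma mul_row_skew a : a *m skew a = 0.
Proof.
apply/matrixP => i j; rewrite ord1 {i} !mxE sum3E !mxE.
by elim/ord3P: j; rewrite !(ord3D, ord3_eq, eqxx); ring.
Qed.

(* Expansion of the triple cross product: [skew b] is a null-homotopy of
   multiplication by [(a *m b^T) 0 0] on the Koszul complex of [a]. *)
Lemma mul_skew_skew a b : skew a *m skew b = b^T *m a - (a *m b^T) 0 0 *: 1%:M.
Proof.
apply/matrixP => i j; rewrite !mxE !sum3E !mxE big_ord1 !mxE.
by elim/ord3P: i; elim/ord3P: j; rewrite !(ord3D, ord3_eq, eqxx, mulr1n, mulr0n); ring.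
Qed.

Lemma tr_skew a : (skew a)^T = - skew a.
Proof.
apply/matrixP => i j; rewrite !mxE.
by elim/ord3P: i; elim/ord3P: j; rewrite !(ord3D, ord3_eq, eqxx); ring.
Qed.

(** Passes from one copy of a complex to [p] copies, one per row; each trimmed generator will occupy
    a row. *)
Lemma rowwise_exact p q s t (A : 'M[R]_(q, s)) (B : 'M[R]_(t, q)) :
  (forall v : 'rV_q, v *m A = 0 -> exists w : 'rV_t, v = w *m B) ->
  forall X : 'M_(p, q), X *m A = 0 -> exists Y : 'M_(p, t), X = Y *m B.
Proof.
move=> ex X XA; have rX i : exists w : 'rV_t, row i X = w *m B.
  by apply: ex; rewrite -row_mul XA row0.
have [w wE] := choice rX; exists (\matrix_i w i).
by apply/row_matrixP => i; rewrite wE row_mul rowK.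
Qed.

Lemma colwise_exact p q s t (A : 'M[R]_(s, q)) (B : 'M[R]_(q, t)) :
  (forall v : 'cV_q, A *m v = 0 -> exists w : 'cV_t, v = B *m w) ->
  forall X : 'M_(q, p), A *m X = 0 -> exists Y : 'M_(t, p), X = B *m Y.
Proof.
move=> ex X XA; have cX i : exists w : 'cV_t, col i X = B *m w.
  by apply: ex; rewrite !colE mulmxA XA mul0mx.
have [w wE] := choice cX; exists (\matrix_(i, j) w j i 0); apply/matrixP => i j.
have := congr1 (fun v : 'cV_q => v i 0) (wE j); rewrite !mxE => ->.
by apply: eq_bigr => k _; rewrite mxE.
Qed.

Variables (m : set R) (x : 'rV[R]_3).
Hypothesis mx : forall a, m a <-> exists y : 'rV_3, a = (y *m x^T) 0 0.

Lemma gen_ideal : is_ideal m.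
Proof.
split=> [|a b|c a]; rewrite !mx.
- by exists 0; rewrite mul0mx mxE.
- by move=> [y ->] [z ->]; exists (y + z); rewrite mulmxDl [RHS]mxE.
- by move=> [y ->]; exists (c *: y); rewrite -scalemxAl [RHS]mxE.
Qed.

Lemma gen_in i : m (x 0 i).
Proof.
by apply/mx; exists (delta_mx 0 i); rewrite -rowE !mxE.
Qed.

(** * Exactness of the Koszul complex, by comparison with the resolution *)

Section Acyclicity.
Variables (n1 n2 n3 : nat) (D1 : 'M[R]_(n1, 1)) (D2 : 'M[R]_(n2, n1)).
Variable D3 : 'M[R]_(n3.+1, n2).
Hypotheses (D32 : D3 *m D2 = 0) (D21 : D2 *m D1 = 0).
Hypothesis exD1 : forall v : 'rV_n1, v *m D1 = 0 -> exists w : 'rV_n2, v = w *m D2.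
Hypothesis exD2 :
  forall v : 'rV_n2, v *m D2 = 0 -> exists w : 'rV_n3.+1, v = w *m D3.
Hypothesis injD3 : forall v : 'rV_n3.+1, v *m D3 = 0 -> v = 0.
Hypothesis mD3 : forall i j, m (D3 i j).

Let injD3M p (X : 'M_(p, n3.+1)) : X *m D3 = 0 -> X = 0.
Proof.
move=> XD; apply/row_matrixP => i; rewrite row0.
by apply: injD3; rewrite -row_mul XD row0.
Qed.

(** A basis vector of F3, the witness that the resolution really reaches degree 3. Multiplying by
    [u^T] on the right reads the coordinate along it. *)
Let u : 'rV[R]_n3.+1 := delta_mx 0 0.

Let uu : u *m u^T = 1%:M.
Proof.
rewrite trmx_delta mul_delta_mx; apply/matrixP => i j.
by rewrite !ord1 !mxE.
Qed.

Let mu j : m ((u *m D3) 0 j).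
Proof. by rewrite -rowE mxE. Qed.

(** An entry of [v] is killed by all of m, hence its multiple of [u] is killed by [D3], whose
    entries lie in m; injectivity of [D3] makes the entry zero. *)
Lemma koszul_inj3 p (v : 'rV_p) : x^T *m v = 0 -> v = 0.
Proof.
move=> xv; apply/rowP => k; rewrite mxE.
have xa i : x 0 i * v 0 k = 0.
  by have /matrixP/(_ i k) := xv; rewrite !mxE big_ord1 mxE.
have ma b : m b -> v 0 k * b = 0.
  move=> /mx [y ->]; rewrite mxE mulr_sumr big1 // => i _.
  by rewrite mxE mulrCA [v 0 k * _]mulrC xa mulr0.
have /injD3 : (v 0 k *: u) *m D3 = 0.
  by rewrite -scalemxAl; apply/rowP => j; rewrite mxE [RHS]mxE ma.
by move=> /matrixP/(_ 0 0); rewrite !mxE !eqxx mulr1.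
Qed.

(** The homotopy writes [w *m (u *m D3)] as a boundary [x^T *m s]. Since [D3 *m D2] is zero and
    [x^T] is injective, [s] is a cycle of F and lifts along [D3]; cancelling [D3] exhibits [w *m u]
    as a boundary. *)
Lemma koszul_exact2 (w : 'cV_3) :
  skew x *m w = 0 -> exists c : 'M_1, w = x^T *m c.
Proof.
move=> xw; have [y yE] := choice (fun j => (mx _).1 (mu j)).
pose s := \row_j (y j *m w) 0 0.
have sE : x^T *m s = w *m (u *m D3).
  apply/matrixP => i j; rewrite [LHS]mxE big_ord1 [RHS]mxE big_ord1 yE [s _ _]mxE.
  have := congr1 (mulmx^~ w) (mul_skew_skew (y j) x).
  rewrite mulmxBl -mulmxA xw mulmx0 -scalemxAl mul1mx => /esym/eqP.
  rewrite subr_eq0 => /eqP/matrixP/(_ i 0).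
  by rewrite -mulmxA [in LHS]mxE big_ord1 => ->; rewrite mxE mulrC.
have /exD2 [s' s'E] : s *m D2 = 0.
  by apply: koszul_inj3; rewrite mulmxA sE -!mulmxA D32 !mulmx0.
have xs' : x^T *m s' = w *m u.
  apply/eqP; rewrite -subr_eq0; apply/eqP/injD3M.
  by rewrite mulmxBl -mulmxA -s'E sE mulmxA subrr.
by exists (s' *m u^T); rewrite mulmxA xs' -mulmxA uu mulmx1.
Qed.

Lemma koszul_exact1 (y : 'cV_3) :
  x *m y = 0 -> exists w : 'cV_3, y = skew x *m w.
Proof.
move=> xy; have [z zE] := choice (fun j => (mx _).1 (mu j)).
(* Column [j] comes from the null-homotopy [skew (z j)] of multiplication by entry [j] of
   [u *m D3]. *)
pose s := \matrix_(i, j) - (skew (z j) *m y) i 0.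
have sE : skew x *m s = y *m (u *m D3).
  apply/matrixP => i j; rewrite [RHS]mxE big_ord1 zE.
  have := congr1 (mulmx^~ y) (mul_skew_skew x (z j)).
  rewrite mulmxBl -!mulmxA xy mulmx0 sub0r -scalemxAl mul1mx.
  move=> /(congr1 -%R)/matrixP/(_ i 0); rewrite opprK [in RHS]mxE.
  rewrite -[x *m _]trmxK trmx_mul trmxK [_^T 0 0]mxE mulrC => <-.
  rewrite !mxE -sumrN; apply: eq_bigr => k _.
  by rewrite [s _ _]mxE mulrN.
have [s2 s2E] : exists s2 : 'rV_n1, s *m D2 = x^T *m s2.
  apply: (colwise_exact (A := skew x)); first exact: koszul_exact2.
  by rewrite mulmxA sE -!mulmxA D32 !mulmx0.
have /exD1 [s3 s3E] : s2 *m D1 = 0.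
  by apply: koszul_inj3; rewrite mulmxA -s2E -mulmxA D21 mulmx0.
(* [s] need not be a cycle for [D2]. The correction [x^T *m s3] makes it one and is invisible to
   [skew x]. *)
have [s4 s4E] : exists s4 : 'M_(3, n3.+1), s - x^T *m s3 = s4 *m D3.
  by apply: rowwise_exact exD2 _ _; rewrite mulmxBl -mulmxA -s3E s2E subrr.
have ys4 : y *m u = skew x *m s4.
  apply/eqP; rewrite -subr_eq0; apply/eqP/injD3M; rewrite mulmxBl -!mulmxA -s4E.
  by rewrite mulmxBr sE [skew x *m _]mulmxA mul_skew_tr mul0mx subr0 subrr.
by exists (s4 *m u^T); rewrite mulmxA -ys4 -mulmxA uu mulmx1.
Qed.

End Acyclicity.

End Koszul.

Lemma basis_on_coord_iso (R : comNzRingType) (M : lmodType R) n (e : 'I_n -> M) :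
  basis_on e -> exists (c : {linear M -> 'rV[R]_n}) (s : {linear 'rV[R]_n -> M}),
    cancel c s /\ cancel s c.
Proof.
move=> eb.
have [c cE] := basis_on_map (fun j => delta_mx 0 j : 'rV[R]_n) eb.
have lin : linear (fun a : 'rV[R]_n => \sum_j a 0 j *: e j).
  move=> k a b; rewrite scaler_sumr -big_split; apply: eq_bigr => j _ /=.
  by rewrite !mxE scalerDl scalerA.
have [s sE] := linear_ex lin.
have cs a : c (s a) = a.
  rewrite sE linear_sum [RHS]row_sum_delta; apply: eq_bigr => j _.
  by rewrite linearZ cE.
exists c, s; split=> //; apply: (basis_on_ext (f := s \o c) (g := idfun) eb) => j /=.
rewrite cE sE (bigD1 j) //= !mxE !eqxx scale1r big1 ?addr0 // => k /negPf kj.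
by rewrite !mxE kj andbF scale0r.
Qed.

(** * The Koszul complex on rows and its minimality *)

Section KoszulMatrices.
Variables (R : comNzRingType) (m : set R) (x : 'rV[R]_3).
Hypothesis mx : forall a, m a <-> exists y : 'rV_3, a = (y *m x^T) 0 0.

Let mid : is_ideal m := gen_ideal mx.

Lemma skew_in i j : m (skew x i j).
Proof.
have [m0 _ mM] := mid; rewrite mxE; case: ifP => _; first exact: gen_in.
by case: ifP => _ //; rewrite -mulN1r; apply: mM; apply: gen_in.
Qed.

Lemma smul_mulmx p q r (A : 'M_(p, q)) (B : 'M_(q, r)) :
  (forall i j, m (B i j)) -> smul m setT (A *m B).
Proof.
move=> mB; apply/(smul_mx _ mid) => i j; rewrite mxE.
by apply: ideal_sum mid _ => k; have [_ _ mM] := mid; apply: mM.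
Qed.

Lemma smul_gens p (g : 'cV_p) :
  smul m setT g -> exists Y : 'M_(p, 3), Y *m x^T = g.
Proof.
move=> /(smul_mx _ mid) mg; have [y yE] := choice (fun i => (mx _).1 (mg i 0)).
exists (\matrix_i y i); apply/colP => i; rewrite yE !mxE; apply: eq_bigr => k _.
by rewrite mxE.
Qed.

(** The chase was done on columns, while trimming uses rows. Transposition exchanges the two, up to
    the sign of [skew x]; bases turn the differentials of [F] into matrices. *)
Lemma koszul_acyclic (J : set R) (F : dg_data R) n1 n2 n3 (f1 : 'I_n1 -> F1 F)
    (f2 : 'I_n2 -> F2 F) (f3 : 'I_n3.+1 -> F3 F) :
  basis_on f1 -> basis_on f2 -> basis_on f3 -> is_free_resolution J F ->
  (forall u : F3 F, smul m [set: F2 F] (d3 F u)) ->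
  [/\ forall p (Y : 'M_(p, 3)), Y *m x^T = 0 -> exists W : 'M_(p, 3), Y = W *m skew x,
      forall p (W : 'M_(p, 3)), W *m skew x = 0 -> exists V : 'M_(p, 1), W = V *m x &
      forall p (V : 'M_(p, 1)), V *m x = 0 -> V = 0].
Proof.
move=> /basis_on_coord_iso [c1 [s1 [c1K s1K]]] /basis_on_coord_iso [c2 [s2 [c2K s2K]]].
move=> /basis_on_coord_iso [c3 [s3 [c3K s3K]]] [_ [_ ex1 ex2 inj3]] md3.
have lin0 : linear (fun v : 'rV[R]_n1 => const_mx (d1 F (s1 v)) : 'rV[R]_1).
  by move=> a v w; rewrite !linearP; apply/matrixP => i j; rewrite !mxE.
have [e1 e1E] := linear_ex lin0.
pose D1 := lin1_mx e1; pose D2 := lin1_mx (c1 \o d2 F \o s2).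
pose D3 := lin1_mx (c2 \o d3 F \o s3).
have D1E v : v *m D1 = const_mx (d1 F (s1 v)) by rewrite mul_rV_lin1 e1E.
have D2E v : v *m D2 = c1 (d2 F (s2 v)) by rewrite mul_rV_lin1.
have D3E v : v *m D3 = c2 (d3 F (s3 v)) by rewrite mul_rV_lin1.
have D1_0 v : v *m D1 = 0 <-> d1 F (s1 v) = 0.
  rewrite D1E; split=> [/matrixP/(_ 0 0)|->]; first by rewrite !mxE.
  by apply/matrixP => i j; rewrite !mxE.
have D32 : D3 *m D2 = 0.
  apply/row_matrixP => i; rewrite row0 row_mul D2E rowE D3E c2K.
  by rewrite (_ : d2 F _ = 0) ?linear0 //; apply/ex2; eexists.
have D21 : D2 *m D1 = 0.
  apply/row_matrixP => i; rewrite row0 row_mul; apply/D1_0.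
  by rewrite rowE D2E c1K; apply/ex1; eexists.
have exD1 (v : 'rV_n1) : v *m D1 = 0 -> exists w : 'rV_n2, v = w *m D2.
  move=> /D1_0/ex1 [z zE]; exists (c2 z).
  by rewrite D2E c2K zE s1K.
have exD2 (v : 'rV_n2) : v *m D2 = 0 -> exists w : 'rV_n3.+1, v = w *m D3.
  rewrite D2E => /(congr1 s1); rewrite c1K linear0 => /ex2 [z zE].
  by exists (c3 z); rewrite D3E c3K zE s2K.
have injD3 (v : 'rV_n3.+1) : v *m D3 = 0 -> v = 0.
  rewrite D3E => /(congr1 s2); rewrite c2K linear0 => d30.
  by rewrite -(s3K v) (_ : s3 v = 0) ?linear0 //; apply: inj3; rewrite linear0.
have mD3 i j : m (D3 i j).
  have -> : D3 i j = (row i D3) 0 j by rewrite [RHS]mxE.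
  rewrite rowE D3E; apply: (smul_mx _ mid).1.
  by apply: smul_lin; apply: md3.
split=> p.
- apply: rowwise_exact => y /(congr1 trmx); rewrite trmx_mul trmxK trmx0 => xy.
  have [w wE] := koszul_exact1 mx D32 D21 exD1 exD2 injD3 mD3 xy.
  exists (- w^T); rewrite -[y]trmxK wE trmx_mul tr_skew.
  by rewrite mulmxN mulNmx.
- apply: rowwise_exact => w /(congr1 trmx).
  rewrite trmx_mul tr_skew trmx0 mulNmx => /eqP; rewrite oppr_eq0 => /eqP xw.
  have [c cE] := koszul_exact2 mx D32 exD2 injD3 mD3 xw.
  by exists c^T; rewrite -[w]trmxK cE trmx_mul trmxK.
- move=> V VX; apply: trmx_inj; rewrite trmx0.
  by apply: (koszul_inj3 mx injD3 mD3); rewrite -trmx_mul VX trmx0.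
Qed.

Hypothesis ex1 : forall p (Y : 'M_(p, 3)),
  Y *m x^T = 0 -> exists W : 'M_(p, 3), Y = W *m skew x.

(** An element of m^2 is also a combination of the generators with coefficients [z] in m. Then
    [y - z] is a relation between the generators, so by exactness it is a combination of Koszul
    relations, whose entries lie in m. *)
Lemma gens_independent (y : 'rV_3) :
  ideal_mul m m ((y *m x^T) 0 0) -> forall c, m (y 0 c).
Proof.
have [m0 mD mM] := mid => my.
have [z [mz zE]] : exists z : 'rV_3, (forall c, m (z 0 c)) /\
    (y *m x^T) 0 0 = (z *m x^T) 0 0.
  move: {my}(_ 0 0) my; apply: (@smul_ind _ R^o).
  - by exists 0; split=> [c|]; rewrite ?mul0mx mxE.
  - move=> _ _ [z [mz ->]] [w [mw ->]]; exists (z + w); split=> [c|].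
      by rewrite mxE; apply: mD.
    by rewrite mulmxDl [RHS]mxE.
  - move=> a b ma /mx [z ->]; exists (a *: z); split=> [c|].
      by rewrite mxE mulrC; apply: mM.
    by rewrite -scalemxAl [RHS]mxE.
have [W WE] : exists W : 'M_(1, 3), y - z = W *m skew x.
  apply: ex1; rewrite mulmxBl; apply/matrixP => i j; rewrite !ord1 [LHS]mxE.
  by rewrite [X in _ + X]mxE zE subrr mxE.
move=> c; rewrite -[y](subrK z) WE mxE; apply: mD => //.
by rewrite mxE; apply: ideal_sum mid _ => k; apply/mM/skew_in.
Qed.

Let m2id : is_ideal (ideal_mul m m) := ideal_mulP m mid.

Lemma koszul_min1 p (Y : 'M_(p, 3)) :
  smul (ideal_mul m m) setT (Y *m x^T) -> smul m setT Y.
Proof.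
rewrite !smul_mx // => mY i j.
have := @gens_independent (row i Y); rewrite -row_mul mxE => /(_ (mY i 0) j).
by rewrite mxE.
Qed.

Lemma koszul_min2 p (W : 'M_(p, 3)) :
  smul (ideal_mul m m) setT (W *m skew x) -> smul m setT W.
Proof.
rewrite !smul_mx // => mW i.
(* Entry [j] of row [i] of [W *m skew x] is a linear form in the generators; this sum is its
   coefficient at generator [d]. *)
have col j d : m (\sum_c W i c * skew (delta_mx 0 d) c j).
  have := @gens_independent (\row_d \sum_c W i c * skew (delta_mx 0 d) c j).
  rewrite (_ : (_ *m x^T) 0 0 = (W *m skew x) i j); last first.
    rewrite !mxE !sum3E !mxE !sum3E !mxE.
    by elim/ord3P: j; rewrite !(ord3D, ord3_eq, eqxx) /=; ring.
  by move=> /(_ (mW i j) d); rewrite mxE.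
have simp := (ord3D, ord3_eq, eqxx, oppr0, mulr0, addr0, add0r, mulr1).
(* For coordinate c of the row, column c + 1 and generator c + 2, modulo 3, have coefficient exactly
   [W i c]. *)
elim/ord3P.
- by have := col 1 2%:R; rewrite sum3E !mxE !simp /= ?simp.
- by have := col 2%:R 0; rewrite sum3E !mxE !simp /= ?simp.
- by have := col 0 1; rewrite sum3E !mxE !simp /= ?simp.
Qed.

Lemma koszul_min3 p (V : 'M_(p, 1)) :
  smul (ideal_mul m m) setT (V *m x) -> smul m setT V.
Proof.
rewrite !smul_mx // => mV i j; rewrite ord1 {j}.
have /(_ 0) : forall c, m ((V i 0 *: delta_mx 0 0 : 'rV_3) 0 c).
  apply: gens_independent; rewrite -scalemxAl -rowE [X in ideal_mul m m X]mxE 2!mxE.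
  by have := mV i 0; rewrite mxE big_ord1.
by rewrite !mxE mulr1.
Qed.

End KoszulMatrices.

(** * The trimming complex *)

Section Trimming.
Variables (R : comNzRingType) (m : set R) (x : 'rV[R]_3).
Hypothesis mx : forall a, m a <-> exists y : 'rV_3, a = (y *m x^T) 0 0.
Local Notation m2 := (ideal_mul m m).

Hypothesis kex1 : forall p (Y : 'M_(p, 3)),
  Y *m x^T = 0 -> exists W : 'M_(p, 3), Y = W *m skew x.
Hypothesis kex2 : forall p (W : 'M_(p, 3)),
  W *m skew x = 0 -> exists V : 'M_(p, 1), W = V *m x.
Hypothesis kinj3 : forall p (V : 'M_(p, 1)), V *m x = 0 -> V = 0.

Variables (F : dg_data R) (s t n2 n3 : nat).
Variables (f2 : 'I_n2 -> F2 F) (f3 : 'I_n3 -> F3 F).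
Hypotheses (f2b : basis_on f2) (f3b : basis_on f3).
Hypothesis Fdg : is_dg_algebra F.
Hypotheses (Fex1 : exact (d2 F) (d1 F)) (Fex2 : exact (d3 F) (d2 F)).
Hypothesis Finj3 : injective (d3 F).
Hypothesis Fmin : is_minimal m F.

(** A splitting of F1 into the span of the kept basis vectors ([iA], [rA]) and that of the trimmed
    ones ([iG], [rG]). The latter uses columns, so that [Y *m x^T] feeds one Koszul row to each
    trimmed generator. *)
Variables (iA : {linear 'rV[R]_s -> F1 F}) (iG : {linear 'cV[R]_t -> F1 F}).
Variables (rA : {linear F1 F -> 'rV[R]_s}) (rG : {linear F1 F -> 'cV[R]_t}).
Hypothesis iAG : forall z, iA (rA z) + iG (rG z) = z.
Hypotheses (rAK : forall a, rA (iA a) = a) (rGK : forall g, rG (iG g) = g).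
Hypotheses (rAG : forall g, rA (iG g) = 0) (rGA : forall a, rG (iA a) = 0).

Hypothesis Fmul_m2 : forall u v : F1 F, smul m2 setT (mul11 F u v).
Hypothesis Fd2_m2 : forall z : F2 F, smul m2 setT (d2 F z).
(** The argument in ['I_t] restricts the claim to the case where something is trimmed, which is
    where a second generator is at hand to force it. *)
Hypothesis Fd1_m2 : forall a, 'I_t -> m2 (d1 F (iA a)).

Let T1 : lmodType R := ('rV[R]_s * 'M[R]_(t, 3))%type.
Let T2 : lmodType R := (F2 F * 'M[R]_(t, 3))%type.
Let T3 : lmodType R := (F3 F * 'M[R]_(t, 1))%type.

Let mid : is_ideal m := gen_ideal mx.
Let m2id : is_ideal m2 := ideal_mulP m mid.
Let m2m : m2 `<=` m := ideal_mul_subr mid.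

(* The Koszul complex on [x], one row per trimmed generator, is glued to [F]
   along comparison maps [Q1] and [Q2]; [y |-> iA y.1 + iG (y.2 *m x^T)] and
   the first projections form a morphism onto [F] compatible with products. *)
Lemma trimming_complex :
  exists (e1 : {linear T1 -> R^o}) (e2 : {linear T2 -> T1})
         (e3 : {linear T3 -> T2}) (mu : T1 -> T1 -> T2) (mu' : T1 -> T2 -> T3)
         (Q2 : {linear F3 F -> 'M[R]_(t, 3)}),
    [/\ is_dg_algebra (DGData e1 e2 e3 mu mu') /\
          is_minimal m (DGData e1 e2 e3 mu mu'),
        [/\ exact e2 e1, exact e3 e2 & injective e3],
        forall y, e1 y = d1 F (iA y.1 + iG (y.2 *m x^T)),
        (forall y y', smul m setT (mu y y')) /\
          (forall u, smul m setT (Q2 u)) &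
        forall y z,
          (mu' y z).1 = mul12 F (iA y.1 + iG (y.2 *m x^T)) z.1 /\
          smul m2 setT (Q2 (mul12 F (iA y.1 + iG (y.2 *m x^T)) z.1) +
                        (mu' y z).2 *m x)].
Proof.
have [Fd1_m Fd2_m Fd3_m] := Fmin.
have xT_in i j : m (x^T i j) by rewrite mxE ord1; apply: gen_in.
have x_in i j : m (x i j) by rewrite ord1; apply: gen_in.
have kmin1 := koszul_min1 mx kex1.
have kmin2 := koszul_min2 mx kex1.
have m2_m (M : lmodType R) (z : M) : smul m2 setT z -> smul m setT z.
  exact: smul_mono.
have [Q1 Q1E] : exists Q1 : {linear F2 F -> 'M[R]_(t, 3)},
    forall z, Q1 z *m x^T = rG (d2 F z).
  apply: (basis_on_lift (f := rG \o d2 F) (g := mulmxr x^T) f2b) => z /=.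
  by apply: smul_gens mx _ _ _; apply: smul_lin.
(* The bound on [d2] enters here: the Koszul boundary of [Q1 z] lies in m^2. *)
have mQ1 z : smul m setT (Q1 z).
  by apply: kmin1; rewrite Q1E; apply: smul_lin.
have [Q2 Q2E] : exists Q2 : {linear F3 F -> 'M[R]_(t, 3)},
    forall u, Q2 u *m skew x = - Q1 (d3 F u).
  apply: (basis_on_lift (f := -%R \o (Q1 \o d3 F)) (g := mulmxr (skew x)) f3b).
  move=> u /=; have [W WE] : exists W : 'M_(t, 3), - Q1 (d3 F u) = W *m skew x.
    by apply: kex1; rewrite mulNmx Q1E (d2_d3 Fdg) linear0 oppr0.
  by exists W.
(* One factor m comes from [d3] and the other from [Q1]. *)
have mQ2 u : smul m setT (Q2 u).
  by apply: kmin2; rewrite Q2E; apply/smulN/smul_lin_mul.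
have [P1 P1E] : exists P1 : {linear T1 -> F1 F},
    forall y, P1 y = iA y.1 + iG (y.2 *m x^T).
  have lin : linear (fun y : T1 => iA y.1 + iG (y.2 *m x^T)).
    move=> a y y' /=; rewrite mulmxDl -scalemxAl !linearP addrACA.
    by rewrite scalerDr.
  by have [P1 P1E] := linear_ex lin; exists P1.
have rAP1 y : rA (P1 y) = y.1 by rewrite P1E linearD rAK rAG addr0.
have rGP1 y : rG (P1 y) = y.2 *m x^T by rewrite P1E linearD rGK rGA add0r.
pose e1 : {linear T1 -> R^o} := d1 F \o P1.
have [e2 e2E] : exists e2 : {linear T2 -> T1},
    forall z, e2 z = (rA (d2 F z.1), Q1 z.1 + z.2 *m skew x).
  have lin : linear (fun z : T2 => (rA (d2 F z.1), Q1 z.1 + z.2 *m skew x) : T1).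
    move=> a z z'; rewrite !linearP mulmxDl -scalemxAl; congr pair => /=.
    by rewrite scalerDr addrACA.
  by have [e2 e2E] := linear_ex lin; exists e2.
have [e3 e3E] : exists e3 : {linear T3 -> T2},
    forall u, e3 u = (d3 F u.1, Q2 u.1 + u.2 *m x).
  have lin : linear (fun u : T3 => (d3 F u.1, Q2 u.1 + u.2 *m x) : T2).
    move=> a u u'; rewrite !linearP mulmxDl -scalemxAl; congr pair => /=.
    by rewrite scalerDr addrACA.
  by have [e3 e3E] := linear_ex lin; exists e3.
have P1e2 z : P1 (e2 z) = d2 F z.1.
  by rewrite P1E e2E /= mulmxDl -mulmxA mul_skew_tr mulmx0 addr0 Q1E iAG.
have e12 z : e1 (e2 z) = 0.
  by rewrite /= P1e2; exact: d1_d2 Fdg _.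
have e23 u : e2 (e3 u) = 0.
  rewrite e3E e2E /= (d2_d3 Fdg) linear0 mulmxDl Q2E -mulmxA mul_row_skew.
  by rewrite mulmx0 addr0 subrr.
(* Here and in the next degree, a cycle is solved first in [F]; what remains is a Koszul cycle,
   handled by exactness of K. *)
have ex1 : exact e2 e1.
  move=> y; split=> [/Fex1 [z zE]|[z <-]]; last exact: e12.
  have [W WE] : exists W : 'M_(t, 3), y.2 - Q1 z = W *m skew x.
    by apply: kex1; rewrite mulmxBl Q1E zE rGP1 subrr.
  by exists (z, W); rewrite e2E /= zE rAP1 -WE addrC subrK -surjective_pairing.
have ex2 : exact e3 e2.
  move=> z; split=> [ez|[u <-]]; last exact: e23.
  have /Fex2 [u uE] : d2 F z.1 = 0 by rewrite -P1e2 ez linear0.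
  have [V VE] : exists V : 'M_(t, 1), z.2 - Q2 u = V *m x.
    apply: kex2; rewrite mulmxBl Q2E opprK uE addrC.
    by have := congr1 snd ez; rewrite e2E.
  by exists (u, V); rewrite e3E /= uE -VE addrC subrK -surjective_pairing.
have inj3 : injective e3.
  have ker w : e3 w = 0 -> w = 0.
    rewrite e3E => ew; have ew1 : d3 F w.1 = 0 := congr1 fst ew.
    have w0 : w.1 = 0 by apply: Finj3; rewrite ew1 linear0.
    have /kinj3 w0' : w.2 *m x = 0.
      by have := congr1 snd ew; rewrite w0 /= linear0 add0r.
    by rewrite [w]surjective_pairing w0 w0'.
  move=> u v uv; apply/eqP; rewrite -subr_eq0; apply/eqP/ker.
  by rewrite linearB uv subrr.
have e1_m2 y : 'I_t -> m2 (e1 y).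
  move=> i; rewrite /= P1E linearD; have [_ m2D _] := m2id; apply: m2D.
    exact: Fd1_m2.
  have gm : smul m setT (y.2 *m x^T) by apply: smul_mulmx mx _ _ _ _ _ xT_in.
  apply/(smul_regular _ m2id); apply: (smul_lin_mul (f := d1 F \o iG)) gm => g.
  by apply/(smul_regular _ mid); apply: Fd1_m.
have m2Z (i1 : T1) (W : 'M_(t, 3)) : smul m2 setT ((e1 i1 : R) *: W).
  apply/(smul_mx _ m2id) => i j; rewrite mxE mulrC.
  by have [_ _ m2M] := m2id; apply/m2M/e1_m2.
(* The Leibniz rule forces the Koszul part [w y y'] of the lifted product to have this boundary. *)
pose om y y' := (e1 y : R) *: y'.2 - (e1 y' : R) *: y.2 -
                Q1 (mul11 F (P1 y) (P1 y')).
have om_m2 y y' : smul m2 setT (om y y').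
  by apply: smulB; [apply: smulB; apply: m2Z|apply: smul_lin].
have [w [wr wl w0 wE]] : exists w : T1 -> T1 -> 'M[R]_(t, 3),
    [/\ forall y, linear (w y), forall y, linear (w^~ y), forall y, w y y = 0 &
      forall y y', w y y' *m skew x = om y y'].
  have T1b := basis_on_pair (fun=> 0 : 'M[R]_(t, 3)) (basis_on_delta_mx R 1 s)
    (basis_on_delta_mx R t 3).
  apply: (basis_on_alt_lift (g := mulmxr (skew x)) T1b) => [y|y|y|y y'].
  - move=> a z z'; rewrite /om [P1 (a *: z + z')]linearP (mul11_linr Fdg) [Q1 _]linearP.
    rewrite [e1 (a *: z + z')]linearP /= !scalerDr scalerDl !scalerA mulrC -!scalerA.
    by rewrite !scalerN !opprD [X in X + _]addrACA [LHS]addrACA.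
  - move=> a z z'; rewrite /om [P1 (a *: z + z')]linearP (mul11_linl Fdg) [Q1 _]linearP.
    rewrite [e1 (a *: z + z')]linearP /= !scalerDr scalerDl !scalerA.
    rewrite [_ * a]mulrC -!scalerA.
    by rewrite !scalerN !opprD [X in X + _]addrACA [LHS]addrACA.
  - by rewrite /om (mul11_alt Fdg) linear0 subr0 subrr.
  have [W WE] : exists W : 'M_(t, 3), om y y' = W *m skew x.
    apply: kex1; rewrite /om !mulmxBl -!scalemxAl Q1E (leibniz11 Fdg).
    by rewrite linearB !linearZ /= !rGP1 subrr.
  by exists W.
have w_m y y' : smul m setT (w y y') by apply: kmin2; rewrite wE.
pose mu y y' : T2 := (mul11 F (P1 y) (P1 y'), w y y').
have [mu' Tdg] : exists mu', is_dg_algebra (DGData e1 e2 e3 mu mu').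
  apply: dg_completion => //.
  - move=> y a z z'; rewrite /mu [P1 (a *: z + z')]linearP (mul11_linr Fdg) wr.
    exact: erefl.
  - move=> y a z z'; rewrite /mu [P1 (a *: z + z')]linearP (mul11_linl Fdg) wl.
    exact: erefl.
  - by move=> y; rewrite /mu (mul11_alt Fdg) w0.
  - move=> y y'; rewrite e2E /mu /= (leibniz11 Fdg) linearB !linearZ /= !rAP1.
    rewrite wE /om [Q1 _ + _]addrC subrK !scalerN; exact: erefl.
have Tmin : is_minimal m (DGData e1 e2 e3 mu mu').
  split=> [y|z|u] /=; first exact: Fd1_m.
    rewrite e2E; apply: smul_pair; first exact: smul_lin.
    by apply: smulD => //; apply: smul_mulmx mx _ _ _ _ _ _; apply: skew_in mx.
  rewrite e3E; apply: smul_pair => //.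
  by apply: smulD => //; apply: smul_mulmx mx _ _ _ _ _ _.
exists e1, e2, e3, mu, mu', Q2; split=> //.
- by move=> y; rewrite /= P1E.
- split=> // y y'; apply: smul_pair => //; exact: m2_m.
move=> y z; rewrite -P1E.
have := leibniz12 Tdg y z; rewrite /= e3E => /[dup] /(congr1 fst) /= fstE.
move=> /(congr1 snd) /= sndE.
have mu1 : (mu' y z).1 = mul12 F (P1 y) z.1.
  by apply: Finj3; rewrite fstE (leibniz12 Fdg) P1e2.
(* The second component of the Leibniz rule equals [e1 y *: z.2 - w y (e2 z)]: the scalar is in m^2,
   and [w] and [e2] each contribute a factor m. *)
split=> //; rewrite -mu1 sndE; apply: smulB; first exact: m2Z.
have [wy wyE] := linear_ex (wr y); rewrite -wyE.
apply: smul_lin_mul; first by move=> z'; rewrite wyE.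
by have [_ + _] := Tmin; apply.
Qed.
End Trimming.

Lemma basis_on_split (R : comNzRingType) (M : lmodType R) (n : nat)
    (e : 'I_n -> M) (A : {set 'I_n}) :
  basis_on e ->
  exists (iA : {linear 'rV[R]_#|~: A| -> M}) (iG : {linear 'cV[R]_#|A| -> M})
    (rA : {linear M -> 'rV[R]_#|~: A|}) (rG : {linear M -> 'cV[R]_#|A|}),
    [/\ (forall a, iA a = \sum_i a 0 i *: e (enum_val i)) /\
          (forall g, iG g = \sum_i g i 0 *: e (enum_val i)),
        forall z, iA (rA z) + iG (rG z) = z,
        (forall a, rA (iA a) = a) /\ (forall g, rG (iG g) = g) &
        (forall g, rA (iG g) = 0) /\ (forall a, rG (iA a) = 0)].
Proof.
move=> eb; have [c [cP cE ce]] := basis_on_coord eb.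
have linA : linear (fun a : 'rV[R]_#|~: A| => \sum_i a 0 i *: e (enum_val i)).
  move=> k a b; rewrite scaler_sumr -big_split; apply: eq_bigr => i _ /=.
  by rewrite !mxE scalerDl scalerA.
have linG : linear (fun g : 'cV[R]_#|A| => \sum_i g i 0 *: e (enum_val i)).
  move=> k a b; rewrite scaler_sumr -big_split; apply: eq_bigr => i _ /=.
  by rewrite !mxE scalerDl scalerA.
have linrA : linear (fun z => \row_(i < #|~: A|) c (enum_val i) z).
  by move=> k y z; apply/rowP => i; rewrite !mxE cP.
have linrG : linear (fun z => \col_(i < #|A|) c (enum_val i) z).
  by move=> k y z; apply/colP => i; rewrite !mxE cP.
have [iA iAE] := linear_ex linA; have [iG iGE] := linear_ex linG.
have [rA rAE] := linear_ex linrA; have [rG rGE] := linear_ex linrG.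
have c_sum k I (r : seq I) (F : I -> R) (h : I -> 'I_n) :
    c k (\sum_(i <- r) F i *: e (h i)) = \sum_(i <- r) F i * (k == h i)%:R.
  have c0 : c k 0 = 0.
    apply: (addrI (c k 0)); have := cP k 1 0 0.
    by rewrite scaler0 !addr0 mul1r => <-.
  elim/big_rec2: _ => // i y z _ <-.
  by rewrite cP ce.
have c_enum (B : {set 'I_n}) (F : 'I_#|B| -> R) k :
    c (enum_val k) (\sum_(i < #|B|) F i *: e (enum_val i)) = F k.
  rewrite c_sum (bigD1 k) //= eqxx mulr1 big1 ?addr0 // => i /negPf ik.
  by rewrite (inj_eq enum_val_inj) eq_sym ik mulr0.
have c_enum0 (B : {set 'I_n}) (F : 'I_#|B| -> R) k :
    k \notin B -> c k (\sum_(i < #|B|) F i *: e (enum_val i)) = 0.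
  move=> kB; rewrite c_sum big1 // => i _; case: eqP => [ki|_]; last exact: mulr0.
  by rewrite ki enum_valP in kB.
exists iA, iG, rA, rG; split; first by split.
- move=> z; rewrite iAE iGE rAE rGE [RHS]cE.
  under eq_bigr do rewrite mxE.
  under [X in _ + X]eq_bigr do rewrite mxE.
  rewrite -(big_enum_val (fun k => c k z *: e k)).
  rewrite -(big_enum_val (fun k => c k z *: e k)) addrC [RHS](bigID (mem A)) /=.
  by congr (_ + _); apply: eq_bigl => k; rewrite inE.
- split=> [a|g]; first by apply/rowP => i; rewrite rAE mxE iAE c_enum.
  by apply/colP => i; rewrite rGE mxE iGE c_enum.
split=> [g|a].
  apply/rowP => i; rewrite rAE !mxE iGE c_enum0 //.
  by have := enum_valP i; rewrite inE.
apply/colP => i; rewrite rGE !mxE iAE c_enum0 //.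
by rewrite inE negbK; apply: enum_valP.
Qed.

(** * Generators of the trimmed ideal and surviving products *)

Section Trimmed.
Variables (R : comNzRingType) (m : set R) (x : 'rV[R]_3).
Hypothesis mx : forall a, m a <-> exists y : 'rV_3, a = (y *m x^T) 0 0.

(** The right-hand side is the image of T1 under its differential, with [Y *m x^T] running over the
    columns with entries in m. *)
Lemma tm_image n (phi : 'I_n -> R) (A : {set 'I_n}) (b : R) :
  tm m phi A b <-> exists (a : 'rV_#|~: A|) (Y : 'M_(#|A|, 3)),
    b = \sum_i a 0 i * phi (enum_val i) + \sum_i (Y *m x^T) i 0 * phi (enum_val i).
Proof.
pose P c := exists (a : 'rV_#|~: A|) (Y : 'M_(#|A|, 3)),
  c = \sum_i a 0 i * phi (enum_val i) + \sum_i (Y *m x^T) i 0 * phi (enum_val i).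
rewrite -/(P b).
have P0 : P 0.
  by exists 0, 0; rewrite mul0mx !big1 ?addr0 // => i _; rewrite mxE mul0r.
have PD c d : P c -> P d -> P (c + d).
  move=> [a [Y ->]] [a' [Y' ->]]; exists (a + a'), (Y + Y').
  rewrite addrACA -!big_split mulmxDl; congr (_ + _); apply: eq_bigr => i _.
    by rewrite mxE mulrDl.
  by rewrite [in RHS]mxE mulrDl.
have PM k c : P c -> P (k * c).
  move=> [a [Y ->]]; exists (k *: a), (k *: Y).
  rewrite mulrDr !mulr_sumr -scalemxAl; congr (_ + _); apply: eq_bigr => i _.
    by rewrite mxE mulrA.
  by rewrite [in RHS]mxE mulrA.
split=> [[y [z [yI zI ->]]]|[a [Y ->]]].
  apply: (PD); [move: y yI|move: z zI];
    apply: (smul_ind (M := R^o) (P := P) P0 PD) => k v.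
    move=> _ [i iA ->]; apply: (PM).
    have iA' : i \in ~: A by rewrite inE.
    exists (delta_mx 0 (enum_rank_in iA' i)), 0.
    rewrite mul0mx [X in _ + X]big1 => [|j _]; last by rewrite mxE mul0r.
    rewrite (bigD1 (enum_rank_in iA' i)) //= mxE !eqxx mul1r enum_rankK_in //.
    by rewrite big1 ?addr0 // => j /negPf ji; rewrite mxE ji andbF mul0r.
  move=> /mx [w ->]; move: v; apply: (@smul_ind _ R^o).
  - by rewrite scaler0.
  - by move=> c d Pc Pd; rewrite scalerDr; apply: PD.
  move=> l _ _ [i iA ->].
  have -> : (w *m x^T) 0 0 *: (l *: (phi i : R^o)) = l * ((w *m x^T) 0 0 * phi i).
    exact: mulrCA.
  apply: (PM); pose j := enum_rank_in iA i.
  exists 0, (delta_mx j 0 *m w); rewrite [X in X + _]big1 => [|k' _]; last first.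
    by rewrite mxE mul0r.
  have entry k' : (delta_mx j 0 *m w *m x^T) k' 0 = (k' == j)%:R * (w *m x^T) 0 0.
    by rewrite -mulmxA mxE big_ord1 mxE eqxx andbT.
  rewrite add0r (bigD1 j) //= entry eqxx mul1r enum_rankK_in //.
  by rewrite big1 ?addr0 // => k' /negPf kj; rewrite entry kj !mul0r.
exists (\sum_i a 0 i * phi (enum_val i)), (\sum_i (Y *m x^T) i 0 * phi (enum_val i)).
split=> //.
  elim/big_ind: _ => [|c d|i _]; [exact: (@smul0 _ R^o)|exact: (@smulD _ R^o)|].
  apply: (@smul_gen _ R^o) => //; exists (enum_val i) => //.
  by have := enum_valP i; rewrite inE.
elim/big_ind: _ => [|c d|i _]; [exact: (@smul0 _ R^o)|exact: (@smulD _ R^o)|].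
apply: (@smul_gen _ R^o).
  by apply/mx; exists (row i Y); rewrite -row_mul [RHS]mxE.
rewrite -[phi _]mul1r; apply: (@smul_gen _ R^o) => //.
by exists (enum_val i) => //; apply: enum_valP.
Qed.

End Trimmed.

(* The indices of the basis elements of T1 and T2 whose product is the
   distinguished element of degree 3; [K1] and [K2] index the Koszul part. *)
Definition paired (n n2 r : nat) (A : {set 'I_n}) (K1 K2 : Type)
    (a : 'I_1 * 'I_#|~: A| + K1) (b : 'I_n2 + K2) : bool :=
  match a, b with
  | inl i, inl j => (enum_val i.2 == j :> nat) && (enum_val i.2 < r)%N
  | _, _ => false
  end.

Lemma card_paired (n n2 r : nat) (A : {set 'I_n}) (K1 K2 : finType) :
  (r <= n)%N -> (r <= n2)%N ->
  #|[pred ab : ('I_1 * 'I_#|~: A| + K1) * ('I_n2 + K2) | paired r ab.1 ab.2]|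
  = (r - #|[pred i in A | (i < r)%N]|)%N.
Proof.
move=> rn rn2.
pose B := [set i : 'I_n | (i \notin A) && (i < r)%N]%SET.
have -> : (r - #|[pred i in A | (i < r)%N]|)%N = #|B|.
  have ABr : (#|[pred i in A | (i < r)%N]| + #|B|)%N = r.
    have rE : (\sum_(i < r) 1)%N = r by rewrite sum_nat_const card_ord muln1.
    rewrite -[RHS]rE -!sum1_card (big_ord_widen n (fun=> 1%N)) //.
    rewrite [in RHS](bigID (mem A)) /=.
    congr (_ + _)%N; apply: eq_bigl => i; rewrite andbC.
      by rewrite inE andbC.
    by rewrite inE.
  by rewrite -[X in (X - _)%N]ABr addKn.
(* A pair is determined by its kept index in F1, which lies below [r]. The value [None] makes [f]
   total; no paired index takes it. *)
pose f (ab : ('I_1 * 'I_#|~: A| + K1) * ('I_n2 + K2)) :=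
  if ab.1 is inl i then Some (enum_val i.2) else None.
rewrite -[LHS]cardsE -(card_in_imset (f := f)); last first.
  move=> [[[i0 i]|?] [j|?]] [[[i0' i']|?] [j'|?]]; rewrite !inE /paired //=.
  move=> /andP[/eqP ij _] /andP[/eqP ij' _] [/enum_val_inj ii'].
  rewrite ii' !ord1; congr (_, inl _); apply: val_inj.
  by rewrite /= -ij -ij' /= ii'.
rewrite -(card_imset B Some_inj); congr #|pred_of_set _|; apply/setP => o.
apply/imsetP/imsetP => [[[[[i0 i]|?] [j|?]]]|[i]]; rewrite !inE /paired //=.
  move=> /andP[_ ir] ->; exists (enum_val i) => //.
  by have := enum_valP i; rewrite !inE ir => ->.
move=> /andP[iA ir] ->; have iA' : i \in ~: A by rewrite inE.
exists (inl (0, enum_rank_in iA' i), inl (Ordinal (leq_trans ir rn2))).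
  by rewrite !inE /paired /= enum_rankK_in ?eqxx.
by rewrite /f /= enum_rankK_in.
Qed.

(** * The Tor-algebra of the trimmed ideal *)

Theorem corollary4p12 (R : comNzRingType) (m : set R) (n : nat)
    (phi : 'I_n -> R) (F : dg_data R) (r n2 n3 : nat) (f1 : 'I_n -> F1 F)
    (f2 : 'I_n2 -> F2 F) (f3 : 'I_n3.+1 -> F3 F) :
  regular_local_ring m 3 ->
  pd_quot_eq (ideal_gen (range phi)) 3 ->
  minimal_dg_resolution m (ideal_gen (range phi)) F ->
  (forall i, d1 F (f1 i) = phi i) ->
  class_G m (ideal_gen (range phi)) r ->
  standard_form m r f1 f2 f3 ->
  (forall x y : F1 F, smul (ideal_mul m m) [set: F2 F] (mul11 F x y)) ->
  (forall z : F2 F, smul (ideal_mul m m) [set: F1 F] (d2 F z)) ->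
  forall sigma : {set 'I_n},
    class_G m (tm m phi sigma) (r - #|[pred i in sigma | (i < r)%N]|).
Proof.
move=> [_ [[_ m1 _] _] _ [g mg]] _ [Fdg Fres Fmin] d1f _.
move=> [f1B f2B f3B [rn rn2 _ tab12]] mul_m2 d2_m2 sigma.
have f1b := is_basis_on f1B; have f2b := is_basis_on f2B.
have f3b := is_basis_on f3B.
pose x := \row_i g i.
have mx a : m a <-> exists y : 'rV_3, a = (y *m x^T) 0 0.
  split=> [|[y ->]]; last first.
    rewrite mxE mg; elim/big_ind: _ => [|b c|i _].
    - exact: (@smul0 _ R^o).
    - exact: (@smulD _ R^o).
    - by rewrite !mxE; apply: (@smul_gen _ R^o) => //; exists i.
  rewrite mg; move: a; apply: (@smul_ind _ R^o).
  - by exists 0; rewrite mul0mx mxE.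
  - by move=> _ _ [y ->] [z ->]; exists (y + z); rewrite mulmxDl [RHS]mxE.
  - move=> b _ _ [i _ <-]; exists (b *: delta_mx 0 i).
    by rewrite -scalemxAl -rowE !mxE.
have mid : is_ideal m := gen_ideal mx.
have m2id : is_ideal (ideal_mul m m) := ideal_mulP m mid.
have [_ _ Fm3] := Fmin.
have [_ [_ ex1 ex2 inj3]] := Fres.
have [kex1 kex2 kinj3] := koszul_acyclic mx f1b f2b f3b Fres Fm3.
have kmin3 := koszul_min3 mx kex1.
have [iA [iG [rA [rG [[iAE iGE] iAG [rAK rGK] [rAG rGA]]]]]] :=
  basis_on_split sigma f1b.
(* [phi k] is the coordinate along [f1 l] of the differential of [f1 k] times [f1 l]. *)
have phi_m2 k l : k != l -> ideal_mul m m (phi k).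
  move=> kl; have := d2_m2 (mul11 F (f1 k) (f1 l)).
  rewrite (leibniz11 Fdg) !d1f.
  have -> : (phi k : R) *: f1 l - (phi l : R) *: f1 k =
      \sum_i (phi k * (i == l)%:R - phi l * (i == k)%:R) *: f1 i.
    under eq_bigr do rewrite scalerBl -!scalerA.
    rewrite sumrB -!scaler_sumr; congr (_ *: _ - _ *: _).
      rewrite (bigD1 l) //= eqxx scale1r big1 ?addr0 // => i /negPf ->.
      exact: scale0r.
    rewrite (bigD1 k) //= eqxx scale1r big1 ?addr0 // => i /negPf ->.
    exact: scale0r.
  move=> /(smul_basis m2id f1b)/(_ l).
  by rewrite eqxx eq_sym (negPf kl) mulr1 mulr0 subr0.
have d1A a : 'I_#|sigma| -> ideal_mul m m (d1 F (iA a)).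
  move=> j; rewrite iAE linear_sum; have [_ _ m2M] := m2id.
  apply: ideal_sum m2id _ => i.
  rewrite linearZ d1f; apply: (m2M); apply: (phi_m2 _ (enum_val j)).
  apply: contraL (enum_valP j) => /eqP <-.
  by have := enum_valP i; rewrite inE.
have [e1 [e2 [e3 [mu [mu' [Q2 [[Tdg Tmin] [Tex1 Tex2 Tinj3] e1E [mu_m Q2_m] mu'E]]]]]]] :=
  trimming_complex mx kex1 kex2 kinj3 f2b f3b Fdg ex1 ex2 inj3 Fmin
    iAG rAK rGK rAG rGA mul_m2 d2_m2 d1A.
pose T := DGData e1 e2 e3 mu mu'.
pose t := #|sigma|; pose s := #|~: sigma|.
pose h1 (a : 'I_1 * 'I_s + 'I_t * 'I_3) : F1 T :=
  match a with
  | inl i => (delta_mx i.1 i.2, 0)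
  | inr j => (0, delta_mx j.1 j.2)
  end.
pose h2 (b : 'I_n2 + 'I_t * 'I_3) : F2 T :=
  match b with inl i => (f2 i, 0) | inr j => (0, delta_mx j.1 j.2) end.
have h1b : basis_on h1.
  exact: (basis_on_pair (fun=> 0) (basis_on_delta_mx R 1 s)
    (basis_on_delta_mx R t 3)).
have h2b : basis_on h2.
  exact: (basis_on_pair (fun=> 0) f2b (basis_on_delta_mx R t 3)).
(* Two indices inherited from [F] fall under its table; a Koszul index in degree 1 maps into m F1,
   and one in degree 2 has no component in F2. *)
have proj_zero a b : ~~ paired r a b -> smul m setT (mu' (h1 a) (h2 b)).1.
  have [mu1 _] := mu'E (h1 a) (h2 b); rewrite mu1 => {mu1}.
  case: a => [[i0 i]|[j c]]; case: b => [k|b]; rewrite /h1 /h2 /=.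
  - move=> npair; rewrite mul0mx linear0 addr0 iAE.
    rewrite (bigD1 i) //= big1 => [|i' /negPf ii']; last first.
      by rewrite mxE ii' andbF scale0r.
    rewrite addr0 mxE !ord1 !eqxx scale1r.
    have := tab12 (enum_val i) k; rewrite /eq_mod.
    by rewrite /paired /= in npair; rewrite (negPf npair) subr0.
  - move=> _; set u := _ + _; have [l lE] := linear_ex (mul12_linr Fdg u).
    by rewrite -lE linear0; apply: smul0.
  - move=> _; have [l lE] := linear_ex (mul12_linl Fdg (f2 k)).
    rewrite -lE linear0 add0r; apply/smul_lin/smul_lin.
    by apply: (smul_mulmx mx) => i' j'; rewrite mxE ord1; apply: (gen_in mx).
  - move=> _; set u := _ + _; have [l lE] := linear_ex (mul12_linr Fdg u).
    by rewrite -lE linear0; apply: smul0.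
have proj_pair a b : paired r a b ->
    smul m setT ((mu' (h1 a) (h2 b)).1 - f3 ord0).
  have [mu1 _] := mu'E (h1 a) (h2 b); rewrite mu1 => {mu1}.
  case: a => [[i0 i]|//]; case: b => [k|//]; rewrite /h1 /h2 /=.
  rewrite /paired /= => pair; rewrite mul0mx linear0 addr0 iAE.
  rewrite (bigD1 i) //= big1 => [|i' /negPf ii']; last first.
    by rewrite mxE ii' andbF scale0r.
  rewrite addr0 mxE !ord1 !eqxx scale1r.
  by have := tab12 (enum_val i) k; rewrite pair.
(* If [u] is in m F3 then [Q2 u] is in m^2, hence so is [V *m x], and the minimality criterion in
   top degree applies. *)
have lift_mem (u : F3 F) (V : 'M_(t, 1)) : smul m setT u ->
    smul (ideal_mul m m) setT (Q2 u + V *m x) -> smul m setT V.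
  move=> mu0 mQ; apply: kmin3; rewrite -[V *m x](addKr (Q2 u)) addrC.
  by apply: smulB => //; apply: smul_lin_mul.
(* All paired products have first component [f3 ord0] modulo m, so their differences satisfy the
   condition of [lift_mem] and their Koszul parts agree modulo m. Any one pair supplies [v0];
   without pairs 0 will do. *)
have [v0 v0E] : exists v0 : 'M[R]_(t, 1), forall a b, paired r a b ->
    smul m setT ((mu' (h1 a) (h2 b)).2 - v0).
  have [[a0 [b0 p0]]|np] :=
    pselect (exists a0 b0, @paired n n2 r sigma ('I_t * 'I_3) ('I_t * 'I_3) a0 b0);
    last first.
    by exists 0 => a b pab; case: np; exists a, b.
  exists (mu' (h1 a0) (h2 b0)).2 => a b pab.
  have [mu1 muQ] := mu'E (h1 a) (h2 b).
  have [mu1' muQ'] := mu'E (h1 a0) (h2 b0).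
  apply: (lift_mem ((mu' (h1 a) (h2 b)).1 - (mu' (h1 a0) (h2 b0)).1)).
    rewrite -(subrKA (f3 ord0)) -[f3 ord0 - _]opprB.
    by apply: smulB; apply: proj_pair.
  rewrite linearB mulmxBl addrACA -opprD mu1 mu1'; exact: smulB.
pose h3 (c : 'I_n3.+1 + 'I_t * 'I_1) : F3 T :=
  match c with
  | inl k => (f3 k, if k == ord0 then v0 else 0)
  | inr j => (0, delta_mx j.1 j.2)
  end.
have h3b : basis_on h3.
  exact: (basis_on_pair (fun k => if k == ord0 then v0 else 0) f3b
    (basis_on_delta_mx R t 1)).
have tab a b : smul m [set: F3 T]
    (mu' (h1 a) (h2 b) - (if paired r a b then h3 (inl ord0) else 0)).
  case: ifPn => [pab|npab].
    rewrite [mu' _ _]surjective_pairing; apply: smul_pair.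
      exact: proj_pair.
    by rewrite /h3 eqxx; apply: v0E.
  rewrite subr0 [mu' _ _]surjective_pairing; apply: smul_pair.
    exact: proj_zero.
  have [mu1 muQ] := mu'E (h1 a) (h2 b); rewrite -mu1 in muQ.
  exact: lift_mem (proj_zero _ _ npab) muQ.
have Tres : is_free_resolution (tm m phi sigma) T.
  split; first by split; [exact: basis_on_finite_free h1b
    | exact: basis_on_finite_free h2b | exact: basis_on_finite_free h3b].
  split=> // b; rewrite (tm_image mx); split=> [[a [Y ->]]|[y <-]].
    exists (a, Y); rewrite /= e1E /= linearD iAE iGE !linear_sum /=.
    by congr (_ + _); apply: eq_bigr => i _; rewrite linearZ d1f.
  exists y.1, y.2; rewrite /= e1E linearD iAE iGE !linear_sum /=.
  by congr (_ + _); apply: eq_bigr => i _; rewrite linearZ d1f.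
have [_ _ Tm3] := Tmin.
(* The class is stated with a successor as rank in degree 3, so the predecessor of the cardinal is
   named; [g3] then sends 0 to the distinguished index. *)
pose N3 := #|{: 'I_n3.+1 + 'I_t * 'I_1}|.-1.
have N3E : N3.+1 = #|{: 'I_n3.+1 + 'I_t * 'I_1}|.
  by rewrite prednK //; apply/card_gt0P; exists (inl ord0).
have [_ [g3 [g3b g30]]] :=
  prefix_enum (s := [:: (inl ord0 : 'I_n3.+1 + 'I_t * 'I_1)]) isT N3E.
(* Renumbering turns the surviving pairs into the diagonal of an initial segment, the shape that
   [G_table] demands. *)
have [] := @prefix_enum_rel _ _ (@paired n n2 r sigma ('I_t * 'I_3) ('I_t * 'I_3))
  _ _ _ _ erefl erefl.
- move=> [[i0 i]|//] [k|//] [k'|//] /andP[/eqP ik _] /andP[/eqP ik' _].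
  by congr inl; apply: val_inj; rewrite /= -ik -ik'.
- move=> [[i0 i]|//] [[i0' i']|//] [k|//] /andP[/eqP ik _] /andP[/eqP ik' _].
  rewrite !ord1; congr (inl (_, _)); apply/enum_val_inj/val_inj.
  by rewrite /= ik ik'.
rewrite card_paired // => le1 le2 [g1 [g2 [g1b g2b gE]]].
have h3s : basis_on (h3 \o g3) := is_basis_on (basis_on_is h3b g3b).
split; first exact: (minimal_pd_quot mid m1 Tres Tm3 h3s).
exists T; split; first by split.
exists _, _, N3, (h1 \o g1), (h2 \o g2), (h3 \o g3); split.
- exact: basis_on_residue.
- exact: basis_on_residue.
- exact: basis_on_residue.
split=> // i j; first by rewrite /eq_mod subr0.
by have := tab (g1 i) (g2 j); rewrite gE /eq_mod /= (g30 (inl ord0)).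
Qed.
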